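(* Let $X$ be a separable reflexive infinite-dimensional Banach space with $|SP_w(X)|=|SP_w(X^* )|=1$. Let $(\tilde x_i)$ represent the unique element of $SP_w(X)$, and assume that the unique element of $SP_w(X^* )$ is equivalent to the sequence $(\tilde x_i^* )$ of biorthogonal functionals of $(\tilde x_i)$ in $[(\tilde x_i)]^*$. Then $(\tilde x_i)$ is equivalent to the unit vector basis of $c_0$ or of $\ell_p$ for some $1\le p<\infty$.
   Context: A normalized basic sequence $(x_i)$ in a Banach space $X$ generates a spreading model $(\tilde x_i)$ if there exist $\varepsilon_n\downarrow 0$ such that for all $n$, all $(a_i)_{i=1}^n\subseteq[-1,1]$ and all $n\le k_1<\cdots<k_n$, $(1+\varepsilon_n)^{-1}\|\sum_{i=1}^n a_i\tilde x_i\|\le\|\sum_{i=1}^n a_ix_{k_i}\|\le(1+\varepsilon_n)\|\sum_{i=1}^n a_i\tilde x_i\|$. Two sequences $(u_i),(v_i)$ are equivalent if there is $C<\infty$ with $C^{-1}\|\sum a_iv_i\|\le\|\sum a_iu_i\|\le C\|\sum a_iv_i\|$ for all finitely supported scalars $(a_i)$. $SP_w(Z)$ denotes the set of equivalence classes of spreading models generated by normalized weakly null sequences in the Banach space $Z$; $[(\tilde x_i)]$ denotes the closed linear span. *)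

(* Defs.v *)
From HB Require Import structures.
From mathcomp Require Import all_boot all_order all_algebra.
From mathcomp Require Import all_classical all_reals all_analysis.
Set Implicit Arguments. Unset Strict Implicit. Unset Printing Implicit Defensive.
Import Order.TTheory GRing.Theory Num.Theory.
Import numFieldNormedType.Exports.
Local Open Scope classical_set_scope.
Local Open Scope ring_scope.

Section Defs.
Variable R : realType.

Section Generic.
Variables (V : lmodType R) (nrm : V -> R).

Definition normalized (x : nat -> V) : Prop := forall i, nrm (x i) = 1.

(* (x_i) is a basic sequence (Grunblum criterion: nonzero terms and uniformly
   bounded initial-segment projections) *)
Definition basic_seq (x : nat -> V) : Prop :=
  (forall i, x i != 0) /\
  exists K : R, forall (a : nat -> R) (m n : nat), (m <= n)%N ->
    nrm (\sum_(i < m) a i *: x i) <= K * nrm (\sum_(i < n) a i *: x i).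

(* (x_i) generates the spreading model (xt_i) (indices shifted to start at 0:
   x (k i) is x_{k_{i+1}} of the paper, so "n <= k_1" reads n <= (k 0).+1) *)
Definition generates_sm (x : nat -> V) (W : normedModType R) (xt : nat -> W) : Prop :=
  exists eps : nat -> R,
    (forall n, eps n.+1 <= eps n) /\ eps @ \oo --> (0 : R) /\
    forall (n : nat) (a : nat -> R) (k : nat -> nat),
      (forall i, (i < n)%N -> `|a i| <= 1) ->
      (n <= (k 0%N).+1)%N ->
      (forall i, (i.+1 < n)%N -> (k i < k i.+1)%N) ->
      (1 + eps n)^-1 * `|\sum_(i < n) a i *: xt i|
        <= nrm (\sum_(i < n) a i *: x (k i)) /\
      nrm (\sum_(i < n) a i *: x (k i))
        <= (1 + eps n) * `|\sum_(i < n) a i *: xt i|.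
End Generic.

Record smodel := SModel { sm_space : normedModType R; sm_seq : nat -> sm_space }.

(* coefficient norms: a finitely supported scalar sequence is given by (a, n),
   meaning (a_0, ..., a_{n-1}, 0, 0, ...) *)
Definition coefnorm := (nat -> R) -> nat -> R.

Definition cnorm (S : smodel) : coefnorm :=
  fun a n => `|\sum_(i < n) a i *: sm_seq S i|.

Definition equiv_cn (N1 N2 : coefnorm) : Prop :=
  exists C : R, 0 < C /\ forall (a : nat -> R) (n : nat),
    C^-1 * N2 a n <= N1 a n /\ N1 a n <= C * N2 a n.

(* norm of sum_{i<n} b_i xt_i^* where the xt_i^* are the biorthogonal functionals
   of (xt_i) in the dual of [(xt_i)]: operator norm, computed on the dense subspace of
   finite linear combinations of the xt_j *)
Definition biorth_cnorm (S : smodel) : coefnorm :=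
  fun b n => sup [set r : R | exists (m : nat) (a : nat -> R),
      `|\sum_(j < m) a j *: sm_seq S j| <= 1 /\
      r = \sum_(i < minn n m) b i * a i].

Definition c0_cn : coefnorm := fun a n => \big[Num.max/0]_(i < n) `|a i|.
Definition lp_cn (p : R) : coefnorm :=
  fun a n => (\sum_(i < n) `|a i| `^ p) `^ p^-1.

Definition unique_class (P : smodel -> Prop) : Prop :=
  (exists S, P S) /\
  forall S1 S2, P S1 -> P S2 -> equiv_cn (cnorm S1) (cnorm S2).

Section Space.
Variable X : completeNormedModType R.

Definition in_dual (f : X -> R) : Prop :=
  (forall (c : R) (x y : X), f (c *: x + y) = c * f x + f y) /\ continuous f.

Definition dual_norm (f : X -> R) : R :=
  sup [set r : R | exists x : X, `|x| <= 1 /\ r = `|f x|].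

Definition in_bidual (Phi : (X -> R) -> R) : Prop :=
  (forall (c : R) (f g : X -> R), in_dual f -> in_dual g ->
     Phi (c *: f + g) = c * Phi f + Phi g) /\
  exists C : R, forall f, in_dual f -> `|Phi f| <= C * dual_norm f.

Definition separable_space : Prop :=
  exists d : nat -> X, forall (x : X) (e : R), 0 < e -> exists n, `|x - d n| < e.

Definition reflexive_space : Prop :=
  forall Phi, in_bidual Phi -> exists x : X, forall f, in_dual f -> Phi f = f x.

Definition infinite_dim : Prop :=
  forall n : nat, exists v : 'I_n -> X,
    forall c : 'I_n -> R, \sum_(i < n) c i *: v i = 0 -> forall i, c i = 0.

Definition weakly_null (x : nat -> X) : Prop :=
  forall f, in_dual f -> (fun n => f (x n)) @ \oo --> (0 : R).

Definition weakly_null_dual (g : nat -> (X -> R)) : Prop :=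
  (forall n, in_dual (g n)) /\
  forall Phi, in_bidual Phi -> (fun n => Phi (g n)) @ \oo --> (0 : R).

Definition SPw (S : smodel) : Prop :=
  exists x : nat -> X, normalized (fun v : X => `|v|) x /\ basic_seq (fun v : X => `|v|) x /\
    weakly_null x /\ generates_sm (fun v : X => `|v|) x (sm_seq S).

Definition SPw_dual (S : smodel) : Prop :=
  exists g : nat -> (X -> R), normalized dual_norm g /\ basic_seq dual_norm g /\
    weakly_null_dual g /\ generates_sm dual_norm g (sm_seq S).
End Space.
End Defs.

(* Main.v *)
Require Import Defs.
From HB Require Import structures.
From mathcomp Require Import all_boot all_order all_algebra.
From mathcomp Require Import all_classical all_reals all_analysis.
From mathcomp Require Import lra ring zify.
Import Order.TTheory GRing.Theory Num.Theory.
Import numFieldNormedType.Exports.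
Local Open Scope classical_set_scope.
Local Open Scope ring_scope.
Set Implicit Arguments. Unset Strict Implicit. Unset Printing Implicit Defensive.

(* Write [N s] for the norm of a finite combination of the spreading model
   with coefficients [s], and [s (x) t] for the sequence of products [s_i t_j]
   in lexicographic order. If [N (s (x) t) <= K N(s) N(t)] failed for every [K], one
   could concatenate rapidly decreasing multiples of worse and worse normalized [t]'s
   into one summable sequence [beta]; the blocks of the weakly null sequence with
   coefficients [beta] would generate a spreading model not dominated by [N],
   against uniqueness. The same holds in the dual space, and pairing norming
   functionals of [s] and [t] turns the dual estimate into
   [N(s) N(t) <= K N (s (x) t)].

   Thus [N] is multiplicative up to a constant. Hence so is its fundamental
   function, which is then equivalent to [n^(1/p)] (or bounded, which gives c_0). Cutting
   a vector into its [L] dyadic levels compares [N] with the l_p norm up to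
   a factor of order [L]; applied to the k-th tensor power of a fixed
   vector the factor grows linearly in [k], so extracting k-th roots removes it. *)

(** * Norms invariant under spreading *)

(** Uniqueness compares two spreading models only up to a constant that depends on the pair, so the
    models built from different [t] have no common bound a priori. Packing all the bad [t] into a
    single [beta] leaves one model and one constant. Packing only bounds [N (s (x) t)] from above,
    since enlarging [beta] enlarges the norm of its blocks. The lower estimate has to come from the
    dual, and the assumption on the biorthogonal functionals is what identifies the coefficient norm
    found there. The block argument is written for a predicate [D] and a function [nrm] on a vector
    space, because the dual is here a set of functions [X -> R] and not a normed type of its own. *)

Definition zipadd (R : realType) (s t : seq R) : seq R :=
  [seq p.1 + p.2 | p <- zip s t].

Definition tensor (R : realType) (s t : seq R) : seq R :=
  [seq x * y | x <- s, y <- t].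

(** Insertion of zeros encodes invariance under spreading, and suppression is unconditionality with
    constant 1. Entries may be deleted but not permuted, so the order of the coefficients matters
    throughout. *)
Record subsym_norm (R : realType) (N : seq R -> R) : Prop := SubsymNorm {
  ssn_insert0 : forall s t, N (s ++ 0 :: t) = N (s ++ t);
  ssn_suppress : forall c s t, N (s ++ t) <= N (s ++ c :: t);
  ssn_scale : forall c s, N [seq c * x | x <- s] = `|c| * N s;
  ssn_zipadd : forall s t, size s = size t -> N (zipadd s t) <= N s + N t;
  ssn_one : N [:: 1] = 1 }.

Section SubsymNormTheory.
Variables (R : realType) (N : seq R -> R).
Hypothesis HN : subsym_norm N.

Lemma ssn_nil : N [::] = 0.
Proof. by have := ssn_scale HN 0 [::]; rewrite /= normr0 mul0r. Qed.

Lemma ssn_subseq s t : subseq s t -> N s <= N t.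
Proof.
suff H r : subseq s t -> N (r ++ s) <= N (r ++ t) by exact: (H [::]).
elim: t s r => [|y t IH] [|x s] r //=.
- move=> _; apply: (le_trans (IH [::] r (sub0seq _))).
  exact: ssn_suppress.
- case: eqP => [->|_] st.
    by rewrite -!cat_rcons; apply: IH.
  by apply: (le_trans (IH _ r st)); apply: ssn_suppress.
Qed.

Lemma ssn_ge0 s : 0 <= N s.
Proof. by rewrite -ssn_nil; apply: ssn_subseq; apply: sub0seq. Qed.

Lemma ssn_singleton c : N [:: c] = `|c|.
Proof. by have := ssn_scale HN c [:: 1]; rewrite /= mulr1 (ssn_one HN) mulr1. Qed.

Lemma ssn_ge_mem c s : c \in s -> `|c| <= N s.
Proof. by rewrite -sub1seq -ssn_singleton => /ssn_subseq. Qed.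

Lemma ssn_mask0 (P : pred R) s :
  N [seq if P x then x else 0 | x <- s] = N [seq x <- s | P x].
Proof.
suff H r : N (r ++ [seq if P x then x else 0 | x <- s]) = N (r ++ [seq x <- s | P x])
  by exact: (H [::]).
elim: s r => [//|x s IH] r /=.
case: (P x); first by rewrite -!cat_rcons IH.
by rewrite (ssn_insert0 HN) IH.
Qed.

Lemma ssn_filter0 s : N [seq x <- s | x != 0] = N s.
Proof.
rewrite -(ssn_mask0 (fun x => x != 0)); congr N.
by rewrite -[RHS]map_id; apply: eq_map => x; case: eqVneq.
Qed.

Lemma ssn_filter_split (P : pred R) s :
  N s <= N [seq x <- s | P x] + N [seq x <- s | ~~ P x].
Proof.
rewrite -(ssn_mask0 P) -(ssn_mask0 (fun x => ~~ P x)).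
have {1}-> : s = zipadd [seq if P x then x else 0 | x <- s]
                    [seq if ~~ P x then x else 0 | x <- s].
  elim: s => //= x s {1}->; congr (_ :: _).
  by case: (P x); rewrite /= ?addr0 ?add0r.
by apply: (ssn_zipadd HN); rewrite !size_map.
Qed.

Lemma ssn_cat s t : N (s ++ t) <= N s + N t.
Proof.
have Z n r u : N (r ++ nseq n 0 ++ u) = N (r ++ u).
  by elim: n => //= n IH; rewrite (ssn_insert0 HN).
have {1}-> : s ++ t = zipadd (s ++ nseq (size t) 0) (nseq (size s) 0 ++ t).
  elim: s => [|x s IH] /=; last by rewrite {1}IH /zipadd /= addr0.
  elim: t => [//|y t IH]; by rewrite {1}IH /zipadd /= add0r.
apply: (le_trans (ssn_zipadd HN _)).
  by rewrite !size_cat !size_nseq.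
by have := Z (size t) s [::]; have := Z (size s) [::] t;
  rewrite /= !cats0 => -> ->.
Qed.

(** The left vector is [u] times the vector with [y] plus [1 - u] times the vector with [0], and
    suppression bounds the latter by the former. *)
Lemma ssn_shrink1 r y u s : 0 <= u <= 1 -> N (r ++ (u * y) :: s) <= N (r ++ y :: s).
Proof.
move=> /andP[u0 u1].
have -> : r ++ (u * y) :: s = zipadd [seq u * x | x <- r ++ y :: s]
    [seq (1 - u) * x | x <- r ++ 0 :: s].
  elim: r => [|z r IH] /=; last first.
    by rewrite {1}IH /zipadd /=; congr (_ :: _); ring.
  rewrite /zipadd /= mulr0 addr0; congr (_ :: _).
  by elim: s => //= z s {1}->; congr (_ :: _); ring.
apply: (le_trans (ssn_zipadd HN _)); first by rewrite !size_map !size_cat.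
rewrite !(ssn_scale HN) !ger0_norm ?subr_ge0// (ssn_insert0 HN).
have := ssn_suppress HN y r s; have := ssn_ge0 (r ++ s).
move: (N _) (N _) => A B A0 AB; nra.
Qed.

Lemma ssn_shrink s t :
  all2 (fun x y => (0 <= x * y) && (`|x| <= `|y|)) s t -> N s <= N t.
Proof.
suff H r : all2 (fun x y => (0 <= x * y) && (`|x| <= `|y|)) s t ->
   N (r ++ s) <= N (r ++ t) by exact: (H [::]).
elim: s t r => [|x s IH] [|y t] r //= /andP[/andP[xy lexy] st].
apply: (@le_trans _ _ (N (r ++ y :: s))); last first.
  by rewrite -!cat_rcons; apply: IH.
have [y0|y0] := eqVneq y 0.
  by move: lexy; rewrite y0 normr0 normr_le0 => /eqP->.
have -> : x = (x / y) * y by rewrite divfK.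
apply: ssn_shrink1.
have xy' : 0 <= x / y.
  have -> : x / y = (x * y) / y ^+ 2 by field.
  by rewrite divr_ge0// sqr_ge0.
rewrite xy' /= -(ger0_norm xy') normrM normfV ler_pdivrMr ?normr_gt0//.
by rewrite mul1r.
Qed.

(** Suppression only controls shrinking that keeps signs. The entries of [s] whose signs agree with
    [t] and, after negation, the remaining ones are bounded separately, which costs the factor 2. *)
Lemma ssn_mono s t : all2 (fun x y => `|x| <= `|y|) s t -> N s <= 2 * N t.
Proof.
move=> st.
pose s1 := [seq if 0 <= p.1 * p.2 then p.1 else 0 | p <- zip s t].
pose s2 := [seq if 0 <= p.1 * p.2 then 0 else p.1 | p <- zip s t].
have sz : size s = size t by move: st; rewrite all2E => /andP[/eqP].
have {1}-> : s = zipadd s1 s2.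
  rewrite /s1 /s2; elim: s t {s1 s2 st} sz => [|x s IH] [|y t] //= [sz].
  rewrite {1}(IH _ sz) /zipadd /=; congr (_ :: _).
  by case: ifP; rewrite ?addr0 ?add0r.
apply: (le_trans (ssn_zipadd HN _)); first by rewrite !size_map.
rewrite mulr2n mulrDl !mul1r; apply: lerD.
  apply: ssn_shrink; rewrite /s1; elim: s t {s1 s2 sz} st => [|x s IH] [|y t] //=.
  move=> /andP[xy /IH ->]; rewrite andbT.
  by case: ifP => [->//|]; rewrite mul0r normr0 normr_ge0 lexx.
have -> : N s2 = N [seq -1 * x | x <- s2] by rewrite (ssn_scale HN) normrN1 mul1r.
apply: ssn_shrink; rewrite /s2; elim: s t {s1 s2 sz} st => [|x s IH] [|y t] //=.
move=> /andP[xy /IH ->]; rewrite andbT.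
case: ifP => [_|]; first by rewrite mulr0 mul0r normr0 normr_ge0 lexx.
move=> /negbT; rewrite -ltNge => /ltW xyn.
by rewrite mulN1r normrN xy andbT mulNr oppr_ge0.
Qed.

End SubsymNormTheory.

(** For positive [k] and [l], estimating [f (k * l)] in two ways shows that [(f k - e) / k] lies
    below [(f l + e) / l]; the slope [c] is the supremum of the former quotients. *)
Lemma quasi_additive_linear (R : realType) (f : nat -> R) (e : R) :
  (forall m n, `|f (m + n)%N - f m - f n| <= e) ->
  exists c, forall n, `|f n - c * n%:R| <= e.
Proof.
move=> fe.
have e0 : 0 <= e by apply: le_trans (fe 0%N 0%N).
have up k l : f (k.+1 * l.+1)%N + e <= k.+1%:R * (f l.+1 + e).
  elim: k => [|k IH]; first by rewrite mul1n mul1r.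
  rewrite mulSn -natr1.
  have := fe l.+1 (k.+1 * l.+1)%N; rewrite ler_norml => /andP[_ ?].
  lra.
have lo k l : k.+1%:R * (f l.+1 - e) <= f (k.+1 * l.+1)%N - e.
  elim: k => [|k IH]; first by rewrite mul1n mul1r.
  rewrite mulSn -natr1.
  have := fe l.+1 (k.+1 * l.+1)%N; rewrite ler_norml => /andP[? _].
  lra.
pose A : set R := [set r | exists k, r = (f k.+1 - e) / k.+1%:R].
have Aub l : ubound A ((f l.+1 + e) / l.+1%:R).
  move=> _ [k ->].
  rewrite ler_pdivrMr ?ltr0n// mulrAC ler_pdivlMr ?ltr0n// mulrC [leRHS]mulrC.
  apply: (le_trans (lo _ _)); apply: le_trans (up _ _).
  by rewrite mulnC; lra.
have A0 : A !=set0 by exists ((f 1%N - e) / 1); exists 0%N.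
exists (sup A) => -[|n].
  by have := fe 0%N 0%N; rewrite mulr0 subr0 add0n subrr add0r normrN.
have h1 : (f n.+1 - e) / n.+1%:R <= sup A.
  by apply: ub_le_sup; [exists ((f 1%N + e) / 1%:R); exact: Aub|exists n].
have h2 : sup A <= (f n.+1 + e) / n.+1%:R by apply: ge_sup.
move: h1 h2; rewrite ler_pdivrMr ?ltr0n// ler_pdivlMr ?ltr0n// => h1 h2.
by rewrite ler_norml; apply/andP; split; lra.
Qed.

(** * Fundamental function *)

(** At [k = 2 * m] one factor [2 ^ m] beats the linear growth in [m] and the other beats the
    constant [(2 * L + 1) * D]. Settling for 2 instead of 1 keeps the comparison elementary and
    later costs only a factor in the constants. *)
Lemma le2_of_powers_linear (R : realType) (x D : R) (L : nat) :
  (forall k, x ^+ k <= (k * L + 1)%:R * D) -> x <= 2.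
Proof.
move=> H; rewrite leNgt; apply/negP => x2.
have D0 : 0 <= D by have := H 0%N; rewrite mul0n mul1r expr0; lra.
have [m mD] : exists m : nat, (2 * L + 1)%:R * D < m%:R.
  exists (Num.trunc ((2 * L + 1)%:R * D)).+1.
  by apply: Num.Theory.truncnS_gt; rewrite ?mulr_ge0.
have := H (2 * m)%N; apply/negP; rewrite -ltNge.
apply: (@lt_le_trans _ _ (2 ^+ (2 * m))); last first.
  by rewrite lerXn2r// ?nnegrE; lra.
have -> : (2 * m = m + m)%N by lia.
rewrite exprD.
have m2 : (m%:R : R) < 2 ^+ m by rewrite -natrX ltr_nat ltn_expl.
have m3 : (((m + m) * L + 1)%:R : R) <= (2 * L + 1)%:R * 2 ^+ m.
  rewrite -natrX -natrM ler_nat; have : (m < 2 ^ m)%N by rewrite ltn_expl.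
  by nia.
apply: (@le_lt_trans _ _ (((2 * L + 1)%:R * 2 ^+ m) * D)).
  by rewrite ler_wpM2r.
rewrite mulrAC ltr_pM2r ?exprn_gt0//; exact: lt_trans mD m2.
Qed.

Fixpoint tensor_power (R : realType) (s : seq R) (k : nat) : seq R :=
  if k is k'.+1 then tensor s (tensor_power s k') else [:: 1].

Lemma sum_powR_tensor (R : realType) (p : R) (s t : seq R) :
  \sum_(x <- tensor s t) `|x| `^ p =
  (\sum_(x <- s) `|x| `^ p) * (\sum_(x <- t) `|x| `^ p).
Proof.
rewrite /tensor big_allpairs_dep mulr_suml; apply: eq_bigr => x _.
by rewrite mulr_sumr; apply: eq_bigr => y _; rewrite normrM powRM.
Qed.

Lemma sum_powR_tensor_power (R : realType) (p : R) (s : seq R) k :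
  \sum_(x <- tensor_power s k) `|x| `^ p = (\sum_(x <- s) `|x| `^ p) ^+ k.
Proof.
elim: k => [|k IH] /=; first by rewrite big_seq1 normr1 powR1 expr0.
by rewrite sum_powR_tensor IH exprS.
Qed.

Lemma tensor_power_bounds (R : realType) (e : R) (s : seq R) k : 0 <= e ->
  all (fun x => e <= `|x| <= 1) s ->
  all (fun x => e ^+ k <= `|x| <= 1) (tensor_power s k).
Proof.
move=> e0 /allP Hs; elim: k => [|k /allP IH] /=; first by rewrite normr1 lexx.
apply/allP => _ /allpairsP[[x y] /= [/Hs/andP[x1 x2] /IH/andP[y1 y2] ->]].
rewrite exprS normrM; apply/andP; split; last by rewrite mulr_ile1.
by rewrite ler_pM// exprn_ge0.
Qed.

Section Fundamental.
Variables (R : realType) (N : seq R -> R) (K : R).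
Hypothesis HN : subsym_norm N.
Hypothesis K1 : 1 <= K.
Hypothesis N_sub : forall s t, N (tensor s t) <= K * (N s * N t).
Hypothesis N_super : forall s t, N s * N t <= K * N (tensor s t).

Let phi n := N (nseq n 1).

Lemma ssn_nseq c n : N (nseq n c) = `|c| * phi n.
Proof.
by rewrite -(ssn_scale HN); congr N; elim: n => //= n ->; rewrite mulr1.
Qed.

Lemma tensor_nseq m n : tensor (nseq m 1) (nseq n 1) = nseq (m * n) 1 :> seq R.
Proof.
elim: m => //= m IH; rewrite mulSn nseqD -IH /tensor /=; congr (_ ++ _).
by elim: n {IH} => //= n ->; rewrite mulr1.
Qed.

Lemma phi_mono m n : (m <= n)%N -> phi m <= phi n.
Proof.
move=> mn; apply: (ssn_subseq HN); rewrite -(subnKC mn) nseqD.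
exact: prefix_subseq.
Qed.

Lemma phi1 : phi 1 = 1. Proof. exact: ssn_one HN. Qed.

Lemma phi_le n : phi n <= n%:R.
Proof.
elim: n => [|n IH]; first by rewrite /phi /= (ssn_nil HN).
rewrite -addn1 /phi nseqD natrD; apply: (le_trans (ssn_cat HN _ _)).
by rewrite lerD// -/(phi 1) phi1.
Qed.

Lemma phi_ge1 n : (0 < n)%N -> 1 <= phi n.
Proof. by move=> n0; rewrite -phi1; exact: phi_mono. Qed.

(** Multiplicativity makes the logarithm of [phi] along powers of 2 additive up to [ln K]. The
    bounds [1 <= phi n <= n] for positive [n] confine the slope to [[0, ln 2]], which later gives
    [p >= 1]. *)
Lemma phi_dyadic : exists c, [/\ 0 <= c, c <= ln 2 & forall k,
  phi (2 ^ k) <= K * expR (c * k%:R) /\ expR (c * k%:R) <= K * phi (2 ^ k)].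
Proof.
have K0 : 0 < K by exact: lt_le_trans ltr01 K1.
have p0 k : 0 < phi (2 ^ k).
  by have := @phi_ge1 (2 ^ k)%N; rewrite expn_gt0 => /(_ isT); lra.
have [|c Hc] := @quasi_additive_linear _ (fun k => ln (phi (2 ^ k))) (ln K).
  move=> m n.
  have E : tensor (nseq (2 ^ m) 1) (nseq (2 ^ n) 1) = nseq (2 ^ (m + n)) 1 :> seq R.
    by rewrite tensor_nseq expnD.
  have := N_sub (nseq (2 ^ m) 1) (nseq (2 ^ n) 1).
  have := N_super (nseq (2 ^ m) 1) (nseq (2 ^ n) 1).
  rewrite E -!/(phi _) => h1 h2.
  have : ln (phi (2 ^ m) * phi (2 ^ n)) <= ln (K * phi (2 ^ (m + n))).
    by rewrite ler_ln// posrE mulr_gt0.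
  have : ln (phi (2 ^ (m + n))) <= ln (K * (phi (2 ^ m) * phi (2 ^ n))).
    by rewrite ler_ln// posrE ?mulr_gt0// mulr_gt0.
  rewrite !lnM ?posrE ?mulr_gt0// => a b.
  by rewrite ler_norml; apply/andP; split; lra.
have {}Hc n : - ln K <= ln (phi (2 ^ n)) - c * n%:R <= ln K.
  by rewrite -ler_norml.
have big (x y : R) : (forall n : nat, x * n%:R <= y) -> x <= 0.
  move=> h; rewrite leNgt; apply/negP => x0.
  have y0 : 0 <= y by have := h 0%N; rewrite mulr0.
  have := h (Num.trunc (y / x)).+1; apply/negP; rewrite -ltNge mulrC -ltr_pdivrMr//.
  by apply: Num.Theory.truncnS_gt; rewrite ?divr_ge0// ltW.
exists c; split.
- rewrite -oppr_le0; apply: (big _ (ln K)) => n.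
  have /andP[_ h] := Hc n.
  have : 0 <= ln (phi (2 ^ n)).
    by rewrite -ln1 ler_ln ?posrE// phi_ge1// expn_gt0.
  lra.
- rewrite -subr_le0; apply: (big _ (ln K)) => n.
  have /andP[h _] := Hc n.
  have : ln (phi (2 ^ n)) <= ln 2 * n%:R.
    rewrite -[leRHS]mulrC mulr_natl -lnXn// ler_ln ?posrE// ?exprn_gt0//.
    by rewrite -natrX phi_le.
  lra.
move=> k; have /andP[h1 h2] := Hc k.
rewrite -[phi _]lnK ?posrE// -[K]lnK ?posrE// -!expRD !ler_expR.
by split; lra.
Qed.

(** A zero slope means that [phi] is bounded. Otherwise [p = ln 2 / c] turns [expR (c * k)] into the
    power [1/p] of [2 ^ k], and an arbitrary [n] is squeezed between consecutive powers of 2; as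
    [1/p <= 1] this loses at most the factor 2. *)
Lemma c0_or_power_fundamental :
  (forall n, phi n <= K) \/
  exists p : R, 1 <= p /\ forall n,
    phi n <= 2 * K * n%:R `^ p^-1 /\ n%:R `^ p^-1 <= 2 * K * phi n.
Proof.
have K0 : 0 < K by exact: lt_le_trans ltr01 K1.
have [c [c0 c2 Hc]] := phi_dyadic.
have ln20 : 0 < ln (2 : R) by rewrite ln_gt0// ltr1n.
have [cz|cN] := eqVneq c 0.
  left=> n; apply: (@le_trans _ _ (phi (2 ^ n))).
    by apply: phi_mono; apply/ltnW; rewrite ltn_expl.
  by have [] := Hc n; rewrite cz mul0r expR0 mulr1.
have {}c0 : 0 < c by rewrite lt_neqAle eq_sym cN.
right; exists (ln 2 / c); split; first by rewrite ler_pdivlMr// mul1r.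
move=> n; rewrite invf_div; set t := c / ln 2.
have t0 : 0 < t by rewrite divr_gt0.
have t1 : t <= 1 by rewrite ler_pdivrMr// mul1r.
case: n => [|n].
  by rewrite powR0 ?gt_eqF// /phi /= (ssn_nil HN) !mulr0.
have /andP[k1 k2] := @trunc_log_bounds 2 n.+1 isT isT.
set k := trunc_log 2 n.+1 in k1 k2.
have E j : expR (c * j%:R) = (2 ^ j)%:R `^ t.
  rewrite /powR pnatr_eq0 -leqn0 leqNgt expn_gt0/= natrX lnXn// -mulr_natr.
  by congr expR; rewrite /t; field; rewrite gt_eqF.
have E2 j : ((2 ^ j.+1)%:R : R) `^ t <= 2 * (2 ^ j)%:R `^ t.
  rewrite expnS natrM powRM// ler_wpM2r ?powR_ge0//.
  by rewrite -[leRHS]powRr1// ler_powR// ler1n.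
have [_ h1] := Hc k; have [h2 _] := Hc k.+1; rewrite E in h1; rewrite E in h2.
have mono a b : (a <= b)%N -> (a%:R : R) `^ t <= b%:R `^ t.
  by move=> ab; rewrite ge0_ler_powR ?nnegrE ?ler_nat// ltW.
split.
  apply: (le_trans (phi_mono (ltnW k2))); apply: (le_trans h2).
  rewrite [2 * K]mulrC -mulrA ler_pM2l//; apply: (le_trans (E2 _)).
  by rewrite ler_pM2l// mono.
apply: (le_trans (mono _ _ (ltnW k2))); apply: (le_trans (E2 _)).
rewrite -mulrA ler_pM2l//; apply: (le_trans h1); rewrite ler_pM2l//.
exact: phi_mono.
Qed.

End Fundamental.

(** * Level sets and tensor powers *)

Section Levels.
Variables (R : realType) (N : seq R -> R) (K p : R).
Hypothesis HN : subsym_norm N.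
Hypothesis K1 : 1 <= K.
Hypothesis N_sub : forall s t, N (tensor s t) <= K * (N s * N t).
Hypothesis N_super : forall s t, N s * N t <= K * N (tensor s t).
Hypothesis p1 : 1 <= p.
Hypothesis phi_p : forall n, N (nseq n 1) <= 2 * K * n%:R `^ p^-1 /\
  n%:R `^ p^-1 <= 2 * K * N (nseq n 1).

Let Sp (s : seq R) := \sum_(x <- s) `|x| `^ p.

Let K0 : 0 < K. Proof. exact: lt_le_trans ltr01 K1. Qed.
Let p0 : 0 < p. Proof. exact: lt_le_trans ltr01 p1. Qed.
Let pN0 : p != 0. Proof. by rewrite gt_eqF. Qed.

Let Sp_ge0 s : 0 <= Sp s.
Proof. by apply: sumr_ge0 => x _; exact: powR_ge0. Qed.

Let powRKl (x : R) : 0 <= x -> (x `^ p) `^ p^-1 = x.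
Proof. by move=> x0; rewrite -powRrM mulfV// powRr1. Qed.

Let powRKr (x : R) : 0 <= x -> (x `^ p^-1) `^ p = x.
Proof. by move=> x0; rewrite -powRrM mulVf// powRr1. Qed.

Let powRp_mono (x y : R) : 0 <= x -> x <= y -> x `^ p <= y `^ p.
Proof. by move=> x0 xy; rewrite ge0_ler_powR ?nnegrE ?(ltW p0) ?(le_trans x0 xy). Qed.

Let powRi_mono (x y : R) : 0 <= x -> x <= y -> x `^ p^-1 <= y `^ p^-1.
Proof.
by move=> x0 xy; rewrite ge0_ler_powR ?nnegrE ?invr_ge0 ?(ltW p0) ?(le_trans x0 xy).
Qed.

(** On one dyadic level [s] is comparable with a constant sequence. The constant [8 * K] collects 2
    from [ssn_mono], 2 from the width of the level and [2 * K] from the estimate of [phi]. *)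
Lemma one_level r s : 0 < r -> all (fun x => r <= `|x| <= 2 * r) s ->
  N s <= 8 * K * Sp s `^ p^-1 /\ Sp s <= (8 * K * N s) `^ p.
Proof.
move=> r0 Hs; set n := size s.
have [h1 h2] := phi_p n; set ph := N (nseq n 1) in h1 h2.
have ph0 : 0 <= ph by exact: ssn_ge0.
have u1 : N s <= 2 * (2 * r * ph).
  have -> : 2 * r * ph = N (nseq n (2 * r)).
    by rewrite (ssn_nseq HN) gtr0_norm// mulr_gt0.
  apply: (ssn_mono HN); rewrite /n; elim: s Hs {n h1 h2 ph ph0} => //= x s IH.
  by move=> /andP[/andP[_ x2] /IH ->]; rewrite andbT [leRHS]gtr0_norm// mulr_gt0.
have u2 : r * ph <= 2 * N s.
  have -> : r * ph = N (nseq n r) by rewrite (ssn_nseq HN) gtr0_norm.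
  apply: (ssn_mono HN); rewrite /n; elim: s Hs {n h1 h2 ph ph0 u1} => //= x s IH.
  by move=> /andP[/andP[x2 _] /IH ->]; rewrite andbT [leLHS]gtr0_norm.
have v1 : n%:R * r `^ p <= Sp s.
  rewrite /Sp /n; elim: s Hs {n h1 h2 ph ph0 u1 u2} => [|x s IH] /=.
    by rewrite mul0r big_nil.
  move=> /andP[/andP[x2 _] /IH h]; rewrite big_cons -add1n natrD mulrDl mul1r lerD//.
  by apply: powRp_mono => //; exact: ltW.
have v2 : Sp s <= n%:R * (2 * r) `^ p.
  rewrite /Sp /n; elim: s Hs {n h1 h2 ph ph0 u1 u2 v1} => [|x s IH] /=.
    by rewrite mul0r big_nil.
  move=> /andP[/andP[_ x2] /IH h]; rewrite big_cons -add1n natrD mulrDl mul1r lerD//.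
  by apply: powRp_mono.
set w := n%:R `^ p^-1 in h1 h2.
have w0 : 0 <= w by exact: powR_ge0.
have nw : n%:R = w `^ p by rewrite powRKr.
split.
  have : w * r <= Sp s `^ p^-1.
    rewrite -[w * r]powRKl ?mulr_ge0 ?(ltW r0)//.
    by apply: powRi_mono; rewrite ?powR_ge0// powRM ?(ltW r0)// -nw.
  move: (Sp s `^ _) => T wT.
  have : ph * r <= 2 * K * w * r by rewrite ler_pM2r.
  have : K * (w * r) <= K * T by rewrite ler_pM2l.
  lra.
apply: (le_trans v2); rewrite nw -powRM ?mulr_ge0 ?(ltW r0)//.
apply: powRp_mono; first by rewrite mulr_ge0// mulr_ge0// ltW.
have : K * (r * ph) <= K * (2 * N s) by rewrite ler_pM2l.
have : r * w <= r * (2 * K * ph) by rewrite ler_pM2l.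
lra.
Qed.

(** The induction splits off the lowest level and pays one term of [one_level] each time. The sum of
    [p]-th powers is additive over levels, so in the second bound the factor [L.+1] stands outside
    the power. *)
Lemma many_levels L s : all (fun x => 2^-1 ^+ L <= `|x| <= 1) s ->
  N s <= L.+1%:R * (8 * K * Sp s `^ p^-1) /\
  Sp s <= L.+1%:R * (8 * K * N s) `^ p.
Proof.
have half0 : 0 < (2^-1 : R) by rewrite invr_gt0.
elim: L s => [|L IH] s.
  move=> Hs; rewrite !mul1r; apply: (@one_level 2^-1) => //.
  apply: sub_all Hs => x; rewrite expr0 mulfV// => /andP[? ->]; rewrite andbT.
  lra.
move=> Hs; pose P (x : R) := 2^-1 ^+ L <= `|x|.
have HP : all (fun x => 2^-1 ^+ L <= `|x| <= 1) [seq x <- s | P x].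
  apply/allP => x; rewrite mem_filter => /andP[Px xs].
  by have /andP[_ ->] := allP Hs _ xs; rewrite -/(P x) Px.
have HnP : all (fun x => 2^-1 ^+ L.+1 <= `|x| <= 2 * 2^-1 ^+ L.+1)
    [seq x <- s | ~~ P x].
  apply/allP => x; rewrite mem_filter => /andP[Px xs].
  have /andP[-> _] := allP Hs _ xs; rewrite exprS mulrA mulfV// mul1r.
  by rewrite ltW// ltNge.
have [a1 a2] := IH _ HP.
have [b1 b2] := one_level (exprn_gt0 L.+1 half0) HnP.
have SpE : Sp s = Sp [seq x <- s | P x] + Sp [seq x <- s | ~~ P x].
  by rewrite /Sp !big_filter (bigID P).
have NP : N [seq x <- s | P x] <= N s by apply: (ssn_subseq HN); exact: filter_subseq.
have NnP : N [seq x <- s | ~~ P x] <= N s.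
  by apply: (ssn_subseq HN); exact: filter_subseq.
have K8 : 0 <= 8 * K by rewrite mulr_ge0// ltW.
rewrite -(natr1 L.+1) !(mulrDl L.+1%:R) !mul1r; split.
  apply: (le_trans (ssn_filter_split HN P s)); apply: lerD.
    apply: (le_trans a1); rewrite ler_wpM2l// ler_wpM2l//.
    by apply: powRi_mono => //; rewrite SpE lerDl.
  apply: (le_trans b1); rewrite ler_wpM2l//.
  by apply: powRi_mono => //; rewrite SpE lerDr.
rewrite SpE; apply: lerD.
  apply: (le_trans a2); rewrite ler_wpM2l//; apply: powRp_mono.
    by rewrite mulr_ge0// ssn_ge0.
  by rewrite ler_wpM2l.
apply: (le_trans b2); apply: powRp_mono; first by rewrite mulr_ge0// ssn_ge0.
by rewrite ler_wpM2l.
Qed.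

Lemma ssn_tensor_power s k : N (tensor_power s k) <= K ^+ k * N s ^+ k /\
  N s ^+ k <= K ^+ k * N (tensor_power s k).
Proof.
elim: k => [|k [IH1 IH2]] /=; first by rewrite !expr0 (ssn_one HN) mulr1.
have s0 := ssn_ge0 HN s; have t0 := ssn_ge0 HN (tensor_power s k).
have Kk : 0 <= K ^+ k by rewrite exprn_ge0// ltW.
rewrite !exprS; split.
  apply: (le_trans (N_sub _ _)); rewrite -!mulrA ler_pM2l//.
  by rewrite [leRHS]mulrCA ler_wpM2l.
apply: (@le_trans _ _ (N s * (K ^+ k * N (tensor_power s k)))).
  by rewrite ler_wpM2l.
rewrite mulrCA -!mulrA [leRHS]mulrCA ler_wpM2l//.
Qed.

(* The factor [L] lost in [many_levels] grows linearly along tensor powers,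
   while the norms are raised to the power [k]. *)
Lemma ssn_lp_unit s : N s = 1 -> 0 \notin s ->
  1 <= 2 * K * Sp s `^ p^-1 /\ Sp s <= (2 * K) `^ p.
Proof.
move=> Ns s0.
have half0 : 0 < (2^-1 : R) by rewrite invr_gt0.
(* The entries are nonzero and, by suppression, at most [N s = 1] in modulus, so finitely many
   levels contain them all. *)
have [L HL] : exists L, all (fun x => 2^-1 ^+ L <= `|x| <= 1) s.
  have s1 : all (fun x => `|x| <= 1) s.
    by apply/allP => x xs; rewrite -Ns (ssn_ge_mem HN).
  elim: s s0 s1 {Ns} => [|x s IH] /=; first by exists 0%N.
  rewrite inE negb_or => /andP[x0 s0] /andP[x1 s1].
  have [L HL] := IH s0 s1.
  have nx : 0 < `|x| by rewrite normr_gt0 eq_sym.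
  have [M HM] : exists M, 2^-1 ^+ M <= `|x|.
    pose M := (Num.trunc (`|x|^-1)).+1.
    exists M; rewrite exprVn -[leRHS]invrK lef_pV2 ?posrE ?invr_gt0 ?exprn_gt0//.
    apply: ltW; apply: (@lt_trans _ _ M%:R).
      by apply: Num.Theory.truncnS_gt; rewrite invr_ge0 ltW.
    by rewrite -natrX ltr_nat ltn_expl.
  have dec m n : (m <= n)%N -> (2^-1 : R) ^+ n <= 2^-1 ^+ m.
    by move=> mn; rewrite ler_wiXn2l// ?ltW// invf_lt1// ltr1n.
  exists (maxn L M); rewrite x1 andbT (le_trans _ HM) ?dec ?leq_maxr//=.
  apply: sub_all HL => y /andP[y1 ->]; rewrite andbT.
  by rewrite (le_trans _ y1)// dec// leq_maxl.
have lev k : all (fun x => 2^-1 ^+ (k * L) <= `|x| <= 1) (tensor_power s k).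
  rewrite mulnC exprM; apply: tensor_power_bounds HL.
  by apply: exprn_ge0; exact: ltW.
have Spk k : Sp (tensor_power s k) = Sp s ^+ k by exact: sum_powR_tensor_power.
have K2 : 0 <= 2 * K by rewrite mulr_ge0// ltW.
have Spp : 0 < Sp s `^ p^-1.
  rewrite powR_gt0// lt_neqAle Sp_ge0 andbT eq_sym.
  case: s Ns s0 {HL lev Spk} => [|x s] /=; first by rewrite (ssn_nil HN) => /eqP; rewrite eq_sym oner_eq0.
  rewrite inE negb_or eq_sym => _ /andP[x0 _]; rewrite /Sp big_cons gt_eqF//.
  by apply: ltr_wpDr; [exact: (Sp_ge0 s)|rewrite powR_gt0 // normr_gt0].
have powX (x y : R) k : 0 <= x -> (x ^+ k) `^ y = (x `^ y) ^+ k.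
  by move=> x0; rewrite -[in LHS]powR_mulrn// -powRrM mulrC powRrM powR_mulrn// powR_ge0.
split.
  (* As [N s = 1], the two bounds combine to [1 <= K^k * (k L + 1) * 8 K * Sp(s)^(k/p)]. Dividing
     isolates a [k]-th power against linear growth. *)
  have : (K * Sp s `^ p^-1)^-1 <= 2.
    apply: (@le2_of_powers_linear _ _ (8 * K) L) => k.
    have [h _] := many_levels (lev k).
    have [_] := ssn_tensor_power s k; rewrite Ns expr1n => h'.
    rewrite exprVn -[_^-1]mul1r ler_pdivrMr ?exprn_gt0 ?mulr_gt0//.
    apply: (le_trans h').
    rewrite exprMn mulrCA ler_pM2l ?exprn_gt0//.
    by apply: (le_trans h); rewrite addn1 Spk powX// !mulrA.
  rewrite -[_^-1]mul1r ler_pdivrMr ?mulr_gt0//; lra.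
have Kp : 0 < K `^ p by rewrite powR_gt0.
have : Sp s / K `^ p <= 2.
  apply: (@le2_of_powers_linear _ _ ((8 * K) `^ p) L) => k.
  have [_ h] := many_levels (lev k).
  have [h' _] := ssn_tensor_power s k; rewrite Ns expr1n mulr1 in h'.
  rewrite expr_div_n ler_pdivrMr ?exprn_gt0// -Spk.
  apply: (le_trans h); rewrite addn1 -!mulrA ler_wpM2l// -powX ?(ltW K0)//.
  rewrite -powRM ?mulr_ge0 ?exprn_ge0 ?(ltW K0)//.
  apply: powRp_mono; first by rewrite mulr_ge0 // mulr_ge0 ?(ltW K0) // (ssn_ge0 HN).
  by rewrite -mulrA ler_pM2l// ler_pM2l.
(* The power [p >= 1] lets the factor 2 be absorbed, as [2 <= 2 ^ p]. *)
rewrite ler_pdivrMr// => h; apply: (le_trans h); rewrite powRM ?(ltW K0)//.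
rewrite ler_wpM2r ?powR_ge0//.
by rewrite -[leLHS]powRr1// ler_powR// ler1n.
Qed.

(** Zeros are discarded first since they belong to no level; scaling to norm 1 does the rest. *)
Lemma ssn_lp s :
  N s <= 2 * K * Sp s `^ p^-1 /\ Sp s `^ p^-1 <= 2 * K * N s.
Proof.
have K2 : 0 <= 2 * K by rewrite mulr_ge0// ltW.
wlog s0 : s / 0 \notin s.
  have sf : 0 \notin [seq x <- s | x != 0] by rewrite mem_filter eqxx.
  move=> /(_ _ sf).
  rewrite (ssn_filter0 HN).
  have -> // : Sp [seq x <- s | x != 0] = Sp s.
  rewrite /Sp big_filter big_mkcond; apply: eq_bigr => x _.
  by case: eqVneq => //= ->; rewrite normr0 powR0.
have [Ns0|Ns0] := eqVneq (N s) 0.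
  case: s s0 Ns0 => [|x s].
    by rewrite (ssn_nil HN) /Sp big_nil powR0 ?invr_eq0// mulr0.
  rewrite inE negb_or eq_sym => /andP[x0 _] Ns.
  have := ssn_ge_mem HN (mem_head x s).
  by rewrite Ns normr_le0 (negbTE x0).
have c0 : 0 < N s by rewrite lt_neqAle eq_sym Ns0 ssn_ge0.
set c := N s in Ns0 c0 *.
have [||h1 h2] := @ssn_lp_unit [seq c^-1 * x | x <- s].
- by rewrite (ssn_scale HN) gtr0_norm ?invr_gt0// mulVf.
- apply/negP => /mapP[x xs /esym/eqP]; rewrite mulf_eq0 invr_eq0 (negbTE Ns0) /=.
  by move=> /eqP x0; rewrite -x0 xs in s0.
have E : Sp [seq c^-1 * x | x <- s] = (c^-1) `^ p * Sp s.
  rewrite /Sp big_map mulr_sumr; apply: eq_bigr => x _.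
  by rewrite normrM powRM// gtr0_norm ?invr_gt0.
have ci : 0 <= c^-1 by rewrite invr_ge0 ltW.
rewrite E powRM ?powR_ge0// powRKl// in h1.
split.
  by move: h1; rewrite mulrCA -ler_pdivrMl ?invr_gt0// invrK mulr1.
have : (c^-1 `^ p * Sp s) `^ p^-1 <= ((2 * K) `^ p) `^ p^-1.
  by rewrite -E; apply: powRi_mono.
rewrite powRM ?powR_ge0// !powRKl// -ler_pdivlMl ?invr_gt0// invrK.
by rewrite mulrC.
Qed.

End Levels.

Theorem multiplicative_ssn (R : realType) (N : seq R -> R) (K : R) :
  subsym_norm N -> 1 <= K ->
  (forall s t, N (tensor s t) <= K * (N s * N t)) ->
  (forall s t, N s * N t <= K * N (tensor s t)) ->
  (forall s c, 0 <= c -> all (fun x => `|x| <= c) s -> N s <= 2 * K * c) \/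
  exists p : R, 1 <= p /\ forall s,
    N s <= 2 * K * (\sum_(x <- s) `|x| `^ p) `^ p^-1 /\
    (\sum_(x <- s) `|x| `^ p) `^ p^-1 <= 2 * K * N s.
Proof.
move=> HN K1 Hsub Hsup.
have [phiK|[p [p1 phip]]] := c0_or_power_fundamental HN K1 Hsub Hsup; last first.
  by right; exists p; split=> // s; exact: ssn_lp.
have K0 : 0 < K by exact: lt_le_trans ltr01 K1.
left=> s c c0 Hs.
apply: (@le_trans _ _ (2 * N (nseq (size s) c))).
  apply: (ssn_mono HN); elim: s Hs => //= x s IH /andP[xc /IH ->].
  by rewrite andbT [leRHS]ger0_norm.
rewrite (ssn_nseq HN) ger0_norm// -mulrA ler_pM2l// mulrC ler_wpM2r//.
Qed.

(** * Spreading models of weakly null sequences *)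

(** The predicate [D] lets the same arguments serve [X] and its dual, where the norm is meaningful
    only on [in_dual] functions. Norming is required only up to [d], since a dual norm is a supremum
    over the unit ball that need not be attained. *)
Record normed_on (R : realType) (V : lmodType R) (D : V -> Prop) (nrm : V -> R) :
  Prop := NormedOn {
  no_D0 : D 0;
  no_lin : forall (c : R) u v, D u -> D v -> D (c *: u + v);
  no_add : forall u v, D u -> D v -> nrm (u + v) <= nrm u + nrm v;
  no_scale : forall (c : R) u, D u -> nrm (c *: u) = `|c| * nrm u;
  no_norming : forall v (d : R), D v -> 0 < d -> exists f : V -> R,
    [/\ forall c u w, D u -> D w -> f (c *: u + w) = c * f u + f w,
        forall u, D u -> `|f u| <= nrm u & nrm v - d <= f v] }.

Definition bounded_functional (R : realType) (V : lmodType R) (D : V -> Prop)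
    (nrm : V -> R) (f : V -> R) : Prop :=
  (forall c u v, D u -> D v -> f (c *: u + v) = c * f u + f v) /\
  exists C, forall v, D v -> `|f v| <= C * nrm v.

Definition wnull (R : realType) (V : lmodType R) (D : V -> Prop)
    (nrm : V -> R) (x : nat -> V) : Prop :=
  (forall n, D (x n)) /\
  forall f, bounded_functional D nrm f -> (fun n => f (x n)) @ \oo --> (0 : R).

Definition weak_spreading_model (R : realType) (V : lmodType R) (D : V -> Prop)
    (nrm : V -> R) (S : smodel R) : Prop :=
  exists x : nat -> V, normalized nrm x /\ basic_seq nrm x /\ wnull D nrm x /\
    generates_sm nrm x (@sm_seq _ S).

Definition sm_norm (R : realType) (S : smodel R) (s : seq R) : R :=
  cnorm S (nth 0 s) (size s).

Definition lcomb (R : realType) (V : lmodType R) (x : nat -> V) (ks : seq nat)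
    (s : seq R) : V :=
  \sum_(p <- zip ks s) p.2 *: x p.1.

Section Lcomb.
Variables (R : realType) (V : lmodType R) (x : nat -> V).

Lemma lcomb_cat ks1 ks2 (s1 s2 : seq R) : size ks1 = size s1 ->
  lcomb x (ks1 ++ ks2) (s1 ++ s2) = lcomb x ks1 s1 + lcomb x ks2 s2.
Proof. by move=> sz; rewrite /lcomb zip_cat// big_cat. Qed.

Lemma lcomb_cons k ks c (s : seq R) :
  lcomb x (k :: ks) (c :: s) = c *: x k + lcomb x ks s.
Proof. by rewrite /lcomb /= big_cons. Qed.

Lemma lcomb_nil s : lcomb x [::] s = 0.
Proof. by rewrite /lcomb; case: s => [|? ?]; rewrite big_nil. Qed.

Lemma lcomb_nil_r ks : lcomb x ks [::] = 0.
Proof. by rewrite /lcomb; case: ks => [|? ?]; rewrite big_nil. Qed.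

Lemma lcomb_scale c ks (s : seq R) :
  lcomb x ks [seq c * a | a <- s] = c *: lcomb x ks s.
Proof.
elim: ks s => [|k ks IH] [|a s] /=; rewrite ?lcomb_nil ?lcomb_nil_r ?scaler0//.
by rewrite !lcomb_cons IH scalerDr scalerA.
Qed.

Lemma lcomb_zipadd ks (s t : seq R) : size ks = size s -> size ks = size t ->
  lcomb x ks (zipadd s t) = lcomb x ks s + lcomb x ks t.
Proof.
elim: ks s t => [|k ks IH] [|a s] [|b t] //=; first by rewrite !lcomb_nil addr0.
by move=> [h1] [h2]; rewrite /zipadd /= !lcomb_cons -/(zipadd _ _) IH// scalerDl addrACA.
Qed.

Lemma lcombE ks (s : seq R) : size ks = size s ->
  lcomb x ks s = \sum_(i < size s) s`_i *: x (nth 0%N ks i).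
Proof.
move=> sz; rewrite /lcomb (big_nth (0%N, 0)) size_zip sz minnn big_mkord.
by apply: eq_bigr => i _; rewrite nth_zip.
Qed.

Lemma lcombE_pad n ks (s : seq R) : size ks = size s -> (size s <= n)%N ->
  forall k, (forall i, (i < size s)%N -> k i = nth 0%N ks i) ->
  \sum_(i < n) s`_i *: x (k i) = lcomb x ks s.
Proof.
move=> sz sn k Hk; rewrite lcombE//.
rewrite -(big_mkord xpredT (fun i => s`_i *: x (k i))) (big_cat_nat (n := size s))//=.
rewrite [X in _ + X]big_nat_cond [X in _ + X]big1 ?addr0; last first.
  by move=> i /andP[/andP[si _] _]; rewrite nth_default// scale0r.
by rewrite big_mkord; apply: eq_bigr => i _; rewrite Hk.
Qed.

Lemma lcomb_iota0 (s : seq R) :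
  lcomb x (iota 0 (size s)) s = \sum_(i < size s) s`_i *: x i.
Proof.
rewrite lcombE ?size_iota//; apply: eq_bigr => i _.
by rewrite nth_iota.
Qed.

End Lcomb.

Lemma sm_norm_mkseq (R : realType) (S : smodel R) a n :
  sm_norm S (mkseq a n) = cnorm S a n.
Proof.
rewrite /sm_norm /cnorm size_mkseq; congr (`|_|).
by apply: eq_bigr => i _; rewrite nth_mkseq.
Qed.

Lemma sm_normE (R : realType) (S : smodel R) (s : seq R) :
  sm_norm S s = `|lcomb (@sm_seq _ S) (iota 0 (size s)) s|.
Proof. by rewrite lcomb_iota0. Qed.

Section NormedOnTheory.
Variables (R : realType) (V : lmodType R) (D : V -> Prop) (nrm : V -> R).
Hypothesis HZ : normed_on D nrm.

Lemma no_D_scale (c : R) u : D u -> D (c *: u).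
Proof. by move=> Du; rewrite -[_ *: _]addr0; apply: (no_lin HZ) => //; exact: no_D0 HZ. Qed.

Lemma no_D_add u v : D u -> D v -> D (u + v).
Proof. by move=> Du Dv; rewrite -[u]scale1r; exact: no_lin HZ _ _ _ Du Dv. Qed.

Lemma no_D_sub u v : D u -> D v -> D (u - v).
Proof. by move=> Du Dv; rewrite addrC -scaleN1r; exact: no_lin HZ _ _ _ Dv Du. Qed.

Lemma no_D_lcomb x ks (s : seq R) : (forall n, D (x n)) -> D (lcomb x ks s).
Proof.
move=> Dx; rewrite /lcomb; elim: (zip ks s) => [|p l IH].
  by rewrite big_nil; exact: no_D0 HZ.
by rewrite big_cons; apply: (no_lin HZ).
Qed.

Lemma no_nrm0 : nrm 0 = 0.
Proof. by have := no_scale HZ 0 (no_D0 HZ); rewrite scale0r normr0 mul0r. Qed.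

Lemma no_nrmN u : D u -> nrm (- u) = nrm u.
Proof. by move=> Du; rewrite -scaleN1r (no_scale HZ)// normrN1 mul1r. Qed.

Lemma no_nrm_ge0 u : D u -> 0 <= nrm u.
Proof.
move=> Du; have DN : D (- u) by rewrite -scaleN1r; exact: no_D_scale.
have := no_add HZ Du DN; rewrite subrr no_nrm0 no_nrmN//; lra.
Qed.

Lemma no_sub_norm u v : D u -> D v -> `|nrm u - nrm v| <= nrm (u - v).
Proof.
move=> Du Dv; have Duv := no_D_sub Du Dv.
have := no_add HZ Duv Dv; rewrite subrK.
have := no_add HZ (no_D_sub Dv Du) Du; rewrite subrK.
rewrite -[v - u]opprB no_nrmN// ler_norml => h1 h2; apply/andP; split; lra.
Qed.

Lemma no_lcomb_le x ks (s : seq R) B : (forall n, D (x n)) ->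
  all (fun k => nrm (x k) <= B) ks -> size ks = size s ->
  nrm (lcomb x ks s) <= (\sum_(a <- s) `|a|) * B.
Proof.
move=> Dx; elim: ks s => [|k ks IH] [|a s] //=.
  by rewrite lcomb_nil no_nrm0 big_nil mul0r.
move=> /andP[kB ksB] [sz]; rewrite lcomb_cons big_cons mulrDl.
apply: (le_trans (no_add HZ (no_D_scale _ (Dx _)) (no_D_lcomb _ _ Dx))).
by rewrite lerD ?IH// (no_scale HZ)// ler_wpM2l.
Qed.

End NormedOnTheory.

(** The content of [generates_sm] without its rates: [J] depends on the length and the precision
    only. [generates_asymptotic] and [asymptotic_generates] pass between the two, the second along a
    subsequence. *)
Definition asymptotic_norm (R : realType) (V : lmodType R) (nrm : V -> R)
    (x : nat -> V) (M : seq R -> R) : Prop :=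
  forall (m : nat) (d : R), 0 < d -> exists J, forall ks s,
    size ks = m -> size s = m -> sorted ltn ks -> all (leq J) ks ->
    `|nrm (lcomb x ks s) - M s| <= d * M s.

Section Generates.
Variables (R : realType) (V : lmodType R) (D : V -> Prop) (nrm : V -> R).
Hypothesis HZ : normed_on D nrm.
Variables (x : nat -> V) (S : smodel R).
Hypothesis Dx : forall n, D (x n).
Hypothesis gen : generates_sm nrm x (@sm_seq _ S).

(** Homogeneity removes the restriction to coefficients in [[-1, 1]], and padding with zeros allows
    vectors shorter than [n]. *)
Lemma generates_sm_seq : exists eps : nat -> R,
  [/\ forall n, 0 <= eps n, (forall m n, (m <= n)%N -> eps n <= eps m), eps @ \oo --> (0 : R) &
  forall n ks s, (size s <= n)%N -> size ks = size s -> sorted ltn ks -> all (leq n) ks ->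
   (1 + eps n)^-1 * sm_norm S s <= nrm (lcomb x ks s) /\
   nrm (lcomb x ks s) <= (1 + eps n) * sm_norm S s].
Proof.
have [eps [dec [lim0 H]]] := gen.
have dec' m n : (m <= n)%N -> eps n <= eps m.
  elim: n => [|n IH]; first by rewrite leqn0 => /eqP->.
  by rewrite leq_eqVlt => /orP[/eqP->//|/IH h]; exact: le_trans (dec n) h.
have eps0 n : 0 <= eps n.
  rewrite leNgt; apply/negP => en.
  have /cvgrPdist_lt/(_ (- eps n)) := lim0; rewrite oppr_gt0 => /(_ en)[m _ Hm].
  have /= := Hm (maxn m n) (leq_maxl _ _); rewrite sub0r normrN.
  have h := dec' _ _ (leq_maxr m n).
  by rewrite ler0_norm; lra.
exists eps; split=> // n ks s sn sz srt ksn.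
have [s0|s0] := eqVneq s [::].
  by rewrite s0 lcomb_nil_r sm_normE lcomb_nil_r normr0 !mulr0 (no_nrm0 HZ).
pose c := (1 + \sum_(a <- s) `|a|)^-1.
have sum0 : 0 <= \sum_(a <- s) `|a| by apply: sumr_ge0.
have c0 : 0 < c by rewrite invr_gt0; lra.
pose cs := [seq c * a | a <- s].
have szc : size cs = size s by rewrite size_map.
(* Beyond the list, indices exceeding the sum of [ks], hence every entry, keep [k] strictly
   increasing; the coefficients there are 0. *)
pose k i := if (i < size s)%N then nth 0%N ks i else (sumn ks + i).+1.
have k1 i : (i < n)%N -> `|nth 0 cs i| <= 1.
  move=> _; have [is_|si] := ltnP i (size s); last first.
    by rewrite nth_default ?szc// normr0.
  rewrite (nth_map 0)// normrM gtr0_norm// /c ler_pdivrMl; last lra.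
  rewrite mulr1; have := mem_nth 0 is_; move: (nth 0 s i) => y.
  move=> ys; rewrite (big_rem y)//=.
  have : 0 <= \sum_(b <- rem y s) `|b| by apply: sumr_ge0.
  lra.
have sz0 : (0 < size s)%N by case: (s) s0.
have k2 : (n <= (k 0%N).+1)%N.
  rewrite /k sz0; apply: leqW.
  by apply: (allP ksn (nth 0%N ks 0)); rewrite mem_nth// sz.
have k3 i : (i.+1 < n)%N -> (k i < k i.+1)%N.
  move=> _; rewrite /k; case: (ltnP i (size s)) => h1; case: (ltnP i.+1 (size s)) => h2.
  - by apply: (sorted_ltn_nth ltn_trans); rewrite ?inE ?sz.
  - have hl : (i < size ks)%N by rewrite sz.
    have := mem_nth 0%N hl; move: (nth _ _ _) => z zs.
    suff : (z <= sumn ks)%N by lia.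
    elim: (ks) zs => //= w l IH; rewrite inE => /orP[/eqP->|/IH]; lia.
  - by lia.
  - by lia.
have [] := H n (nth 0 cs) k k1 k2 k3.
rewrite (@lcombE_pad _ _ x n ks cs) ?szc//; last first.
  by move=> i ih; rewrite /k ih.
have -> : \sum_(i < n) nth 0 cs i *: sm_seq S i = lcomb (@sm_seq _ S) (iota 0 (size s)) cs.
  apply: (@lcombE_pad _ _ _ _ _ _ _ _ (fun i => i)); rewrite ?szc ?size_iota//.
  by move=> i ih; rewrite nth_iota.
rewrite /cs !lcomb_scale normrZ (no_scale HZ); last exact: (no_D_lcomb HZ _ _ Dx).
rewrite -sm_normE gtr0_norm//.
by rewrite !(mulrCA _ c) !ler_pM2l.
Qed.

Lemma generates_upper : exists2 E : R, 0 < E & forall ks s, size ks = size s ->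
  sorted ltn ks -> all (leq (size s)) ks -> nrm (lcomb x ks s) <= E * sm_norm S s.
Proof.
have [eps [e0 dec _ H]] := generates_sm_seq; exists (1 + eps 0%N).
  by have := e0 0%N; lra.
move=> ks s sz srt al; have [_ h] := H (size s) ks s (leqnn _) sz srt al.
apply: (le_trans h); rewrite ler_wpM2r//; first exact: normr_ge0.
by rewrite lerD2l dec.
Qed.

Lemma generates_asymptotic : asymptotic_norm nrm x (sm_norm S).
Proof.
move=> m d d0; have [eps [e0 dec lim0 H]] := generates_sm_seq.
have /cvgrPdist_le/(_ _ d0)[n0 _ Hn0] := lim0.
pose n := maxn n0 m.
have en : eps n <= d.
  by have /= := Hn0 n (leq_maxl _ _); rewrite sub0r normrN ger0_norm.
exists n => ks s szk szs srt al.
have [||||h1 h2] := H n ks s; rewrite ?szs ?szk ?leq_maxr//.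
have M0 : 0 <= sm_norm S s by exact: normr_ge0.
have e1 : 0 < 1 + eps n by have := e0 n; lra.
move: h1; rewrite mulrC ler_pdivrMr// => h1.
have n0' : 0 <= nrm (lcomb x ks s) by apply: (no_nrm_ge0 HZ); exact: (no_D_lcomb HZ _ _ Dx).
move: h1 h2 (e0 n) en M0 n0' e1; move: (nrm _) (sm_norm _ _) (eps n) => A B e h1 h2 he en M0 A0 e1.
have h3 : e * B <= d * B by rewrite ler_wpM2r.
have h4 : A * e <= (1 + e) * B * e by rewrite ler_wpM2r.
rewrite ler_norml; apply/andP; split; last lra.
have [AB|AB] := leP B A; first by have := mulr_ge0 he M0; lra.
have : A * e <= B * e by rewrite ler_wpM2r// ltW.
lra.
Qed.

End Generates.

Lemma le_of_vanishing_error (R : realType) (A B C : R) :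
  (forall d, 0 < d -> A <= B + d * C) -> A <= B.
Proof.
move=> H; rewrite leNgt; apply/negP => BA.
have C1 : 0 < 2 * (`|C| + 1) by rewrite mulr_gt0// ltr_wpDl.
have d0 : 0 < (A - B) / (2 * (`|C| + 1)) by rewrite divr_gt0// subr_gt0.
have := H _ d0; apply/negP; rewrite -ltNge.
set d := _ / _ in d0 *.
have : d * C <= d * (`|C| + 1) by rewrite ler_pM2l//; have := ler_norm C; lra.
have : d * (2 * (`|C| + 1)) = A - B by rewrite /d divfK// gt_eqF.
lra.
Qed.

Lemma sorted_ltn_cat (s t : seq nat) :
  sorted ltn (s ++ t) = [&& allrel ltn s t, sorted ltn s & sorted ltn t].
Proof. by rewrite !(sorted_pairwise ltn_trans) pairwise_cat. Qed.

Section Cluster.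
Variables (R : realType) (V : lmodType R) (D : V -> Prop) (nrm : V -> R).
Hypothesis HZ : normed_on D nrm.

(** The limit along an ultrafilter refining [\oo] exists at every [u] by boundedness, and linearity
    and the bound survive it. The set [A u] gathers the [t] below [f r u] for ultrafilter many [r],
    so its supremum is this limit. *)
Lemma bounded_functional_cluster (f : nat -> V -> R) :
  (forall r c u v, D u -> D v -> f r (c *: u + v) = c * f r u + f r v) ->
  (forall r u, D u -> `|f r u| <= nrm u) ->
  exists2 g, bounded_functional D nrm g & forall u, D u -> forall d, 0 < d ->
    forall r0, exists2 r, (r0 <= r)%N & `|f r u - g u| < d.
Proof.
move=> flin fb.
have [U [UU ooU]] := @ultraFilterLemma nat \oo _.
pose A u := [set t | U [set r | t <= f r u]].
have notempty B : U B -> exists r, B r by move=> /filter_ex.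
have Aub u : D u -> ubound (A u) (nrm u).
  move=> Du t /= /notempty[r /= tr]; apply: (le_trans tr).
  by apply: le_trans (fb r _ Du); exact: ler_norm.
have A0 u : D u -> A u !=set0.
  move=> Du; exists (- nrm u) => /=; apply: filterS filterT => r _ /=.
  by have := fb r _ Du; rewrite ler_norml => /andP[].
pose g u := sup (A u).
have Hg u (e : R) : D u -> 0 < e -> U [set r | `|f r u - g u| < e].
  move=> Du e0.
  have hs : has_sup (A u) by split; [exact: A0|exists (nrm u); exact: Aub].
  have [t /= At gt] := sup_adherent e0 hs.
  have : U [set r | f r u < g u + e].
    have [//|nU] := in_ultra_setVsetC [set r | f r u < g u + e] UU.
    have : A u (g u + e).
      by apply: filterS nU => r /= /negP; rewrite -leNgt.
    by move=> /(sup_ubound (proj2 hs)); rewrite -/(g u); lra.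
  apply: filterS2 At => r /= h1 h2.
  by rewrite ltr_norml; apply/andP; split; rewrite -/(g u) in gt; lra.
exists g; last first.
  move=> u Du d d0 r0.
  have : U [set r | (r0 <= r)%N] by apply: ooU; exists r0.
  by move=> /(filterI (Hg u d Du d0))/notempty[r /= [h1 h2]]; exists r.
split.
  move=> c u v Du Dv.
  have Duv : D (c *: u + v) by exact: (no_lin HZ).
  suff key (d : R) : 0 < d -> `|g (c *: u + v) - (c * g u + g v)| <= 0 + d * (2 + `|c|).
    by apply/eqP; rewrite -subr_eq0 -normr_le0; apply: le_of_vanishing_error key.
  move=> d0.
  have [r [h1 h2 h3]] : exists r, [/\ `|f r (c *: u + v) - g (c *: u + v)| < d,
      `|f r u - g u| < d & `|f r v - g v| < d].
    by apply: notempty; apply: filterS3 (Hg _ _ Duv d0) (Hg _ _ Du d0) (Hg _ _ Dv d0).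
  move: h1; rewrite flin// => h1.
  have -> : g (c *: u + v) - (c * g u + g v) =
     - (c * f r u + f r v - g (c *: u + v)) + c * (f r u - g u) + (f r v - g v) by ring.
  apply: (le_trans (ler_normD _ _)); apply: (le_trans (lerD (ler_normD _ _) (lexx _))).
  rewrite normrN normrM.
  have : `|c| * `|f r u - g u| <= `|c| * d by rewrite ler_wpM2l// ltW.
  lra.
exists 1 => u Du; rewrite mul1r; apply: (@le_of_vanishing_error _ _ _ 1) => d d0.
have /notempty[r /= h] := Hg _ _ Du d0; have := fb r _ Du.
have -> : g u = f r u - (f r u - g u) by ring.
have := ler_normB (f r u) (f r u - g u); lra.
Qed.

End Cluster.

Section SpreadingModelNorm.
Variables (R : realType) (V : lmodType R) (D : V -> Prop) (nrm : V -> R).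
Hypothesis HZ : normed_on D nrm.
Variables (x : nat -> V) (S : smodel R).
Hypothesis xnorm : normalized nrm x.
Hypothesis xnull : wnull D nrm x.
Hypothesis gen : generates_sm nrm x (@sm_seq _ S).

Let Dx : forall n, D (x n) := proj1 xnull.
Let N := sm_norm S.

Lemma sm_norm_scale c s : N [seq c * a | a <- s] = `|c| * N s.
Proof. by rewrite /N !sm_normE size_map lcomb_scale normrZ. Qed.

Lemma sm_norm_zipadd s t : size s = size t -> N (zipadd s t) <= N s + N t.
Proof.
move=> sz; rewrite /N !sm_normE size_map size_zip sz minnn lcomb_zipadd ?size_iota//.
exact: ler_normD.
Qed.

Lemma sm_norm_one : N [:: 1] = 1.
Proof.
suff key (d : R) : 0 < d -> `|N [:: 1] - 1| <= 0 + d * N [:: 1].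
  by apply/eqP; rewrite -subr_eq0 -normr_le0; apply: le_of_vanishing_error key.
move=> d0; have [J HJ] := generates_asymptotic HZ Dx gen 1 d0.
have := HJ [:: J] [:: 1] erefl erefl erefl; rewrite /= leqnn => /(_ isT).
by rewrite lcomb_cons lcomb_nil addr0 scale1r xnorm add0r distrC.
Qed.

(** Skipping the index [k] that carries the coefficient 0 leaves one and the same vector, whose norm
    approximates both sides. *)
Lemma sm_norm_insert0 s t : N (s ++ 0 :: t) = N (s ++ t).
Proof.
suff key (d : R) : 0 < d -> `|N (s ++ 0 :: t) - N (s ++ t)| <=
    0 + d * (N (s ++ 0 :: t) + N (s ++ t)).
  by apply/eqP; rewrite -subr_eq0 -normr_le0; apply: le_of_vanishing_error key.
move=> d0.
have [J1 H1] := generates_asymptotic HZ Dx gen (size s + (size t).+1) d0.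
have [J2 H2] := generates_asymptotic HZ Dx gen (size s + size t) d0.
pose J := maxn J1 J2.
pose ks := iota J (size s); pose k := (J + size s)%N; pose ls := iota k.+1 (size t).
have kl : sorted ltn (ks ++ k :: ls).
  have -> : ks ++ k :: ls = iota J (size s + (size t).+1) by rewrite iotaD.
  exact: iota_ltn_sorted.
have klJ : all (leq J) (ks ++ k :: ls).
  have -> : ks ++ k :: ls = iota J (size s + (size t).+1) by rewrite iotaD.
  by apply/allP => i; rewrite mem_iota => /andP[].
have sub : subseq (ks ++ ls) (ks ++ k :: ls) by rewrite cat_subseq// subseq_cons.
have kl' : sorted ltn (ks ++ ls) by exact: (subseq_sorted ltn_trans) sub kl.
have klJ' : all (leq J) (ks ++ ls).
  by apply/allP => i /(mem_subseq sub); apply: (allP klJ).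
have Jle i (l : seq nat) : (i <= J)%N -> all (leq J) l -> all (leq i) l.
  by move=> iJ; apply: sub_all => j; exact: leq_trans.
have h1 := H1 (ks ++ k :: ls) (s ++ 0 :: t).
have h2 := H2 (ks ++ ls) (s ++ t).
rewrite !size_cat /= !size_iota in h1 h2.
have {}h1 := h1 erefl erefl kl (Jle _ _ (leq_maxl _ _) klJ).
have {}h2 := h2 erefl erefl kl' (Jle _ _ (leq_maxr _ _) klJ').
have E : lcomb x (ks ++ k :: ls) (s ++ 0 :: t) = lcomb x (ks ++ ls) (s ++ t).
  by rewrite !lcomb_cat ?size_iota// lcomb_cons scale0r add0r.
rewrite E in h1; rewrite -/N in h1 h2.
rewrite add0r mulrDr; move: h1 h2; rewrite !ler_norml => /andP[? ?] /andP[? ?].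
by apply/andP; split; lra.
Qed.

(* Almost norming functionals [f r] of vectors whose tail indices tend to
   infinity cluster at a functional [g]; weak nullity makes [g (x p)], hence
   some [f r (x p)], negligible at an index [p] in the gap. *)
Lemma sm_norm_suppress c s t : N (s ++ t) <= N (s ++ c :: t).
Proof.
apply: (@le_of_vanishing_error _ _ _ (N (s ++ t) + N (s ++ c :: t) + 1 + 2 * `|c|)).
move=> d d0.
have [J1 H1] := generates_asymptotic HZ Dx gen (size s + (size t).+1) d0.
have [J2 H2] := generates_asymptotic HZ Dx gen (size s + size t) d0.
pose J := maxn J1 J2.
(* Only the position of the tail depends on [r], so all [v r] share their coefficients while the gap
   after [ks] widens. *)
pose ks := iota J (size s); pose ls r := iota (J + size s + r).+1 (size t).
pose v r := lcomb x (ks ++ ls r) (s ++ t).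
have Dv r : D (v r) by exact: (no_D_lcomb HZ _ _ Dx).
have /choice[f Hf] r := no_norming HZ (Dv r) d0.
have [||g gb gc] := @bounded_functional_cluster _ _ _ _ HZ f.
- by move=> r; have [] := Hf r.
- by move=> r; have [] := Hf r.
have := proj2 xnull g gb => /cvgrPdist_lt/(_ d d0)[p0 _ Hp0].
pose p := maxn p0 (J + size s)%N.
have gp : `|g (x p)| < d.
  by have /= := Hp0 p (leq_maxl _ _); rewrite sub0r normrN.
(* The index [p] is fixed by [g] before [r] is chosen; [r >= p] then places the tail of [v r] beyond
   [p]. *)
have [r pr fr] := gc _ (Dx p) d d0 p.
have pJ : (J + size s <= p)%N by exact: leq_maxr.
have kl : sorted ltn (ks ++ p :: ls r).
  rewrite sorted_ltn_cat iota_ltn_sorted /=; apply/andP; split.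
    apply/allrelP => i j; rewrite !inE !mem_iota => /andP[h1 h2] /orP[/eqP->|]; lia.
  have : sorted ltn ([:: p] ++ ls r).
    rewrite sorted_ltn_cat iota_ltn_sorted !andbT.
    by apply/allrelP => i j; rewrite !inE mem_iota => /eqP-> /andP[]; lia.
  by [].
have klJ : all (leq J) (ks ++ p :: ls r).
  apply/allP => i; rewrite mem_cat inE !mem_iota; lia.
have sub : subseq (ks ++ ls r) (ks ++ p :: ls r) by rewrite cat_subseq// subseq_cons.
have kl' : sorted ltn (ks ++ ls r) by exact: (subseq_sorted ltn_trans) sub kl.
have klJ' : all (leq J) (ks ++ ls r).
  by apply/allP => i /(mem_subseq sub); apply: (allP klJ).
have Jle i (l : seq nat) : (i <= J)%N -> all (leq J) l -> all (leq i) l.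
  by move=> iJ; apply: sub_all => j; exact: leq_trans.
have h1 := H1 (ks ++ p :: ls r) (s ++ c :: t).
have h2 := H2 (ks ++ ls r) (s ++ t).
rewrite !size_cat /= !size_iota in h1 h2.
have {}h1 := h1 erefl erefl kl (Jle _ _ (leq_maxl _ _) klJ).
have {}h2 := h2 erefl erefl kl' (Jle _ _ (leq_maxr _ _) klJ').
have E : lcomb x (ks ++ p :: ls r) (s ++ c :: t) = c *: x p + v r.
  by rewrite /v !lcomb_cat ?size_iota// lcomb_cons addrCA.
rewrite E in h1; rewrite -/(v r) in h2; rewrite -/N in h1 h2.
have [fl fb fn] := Hf r.
have Dcv : D (c *: x p + v r) by exact: (no_lin HZ).
have h3 : f r (c *: x p + v r) <= nrm (c *: x p + v r).
  exact: le_trans (ler_norm _) (fb _ Dcv).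
rewrite fl// in h3.
have h4 : `|c * f r (x p)| <= `|c| * (2 * d).
  rewrite normrM ler_wpM2l//.
  have -> : f r (x p) = (f r (x p) - g (x p)) + g (x p) by ring.
  apply: (le_trans (ler_normD _ _)); lra.
move: h1 h2 h4; rewrite !ler_norml => /andP[? ?] /andP[? ?] /andP[? ?].
lra.
Qed.

Lemma sm_norm_ssn : subsym_norm N.
Proof.
split; [exact: sm_norm_insert0|exact: sm_norm_suppress|exact: sm_norm_scale
  |exact: sm_norm_zipadd|exact: sm_norm_one].
Qed.

End SpreadingModelNorm.

(** * Block sequences and their spreading models *)

Lemma ssn_nseq0 (R : realType) (N : seq R -> R) (HN : subsym_norm N) s k :
  N (s ++ nseq k 0) = N s.
Proof.
elim: k => [|k IH] /=; first by rewrite cats0.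
by rewrite (ssn_insert0 HN).
Qed.

Lemma mkseq_nth_pad (R : realType) (s : seq R) n : (size s <= n)%N ->
  mkseq (nth 0 s) n = s ++ nseq (n - size s) 0.
Proof.
move=> sn; apply: (@eq_from_nth _ 0).
  by rewrite size_mkseq size_cat size_nseq subnKC.
rewrite size_mkseq => i ilt; rewrite nth_mkseq// nth_cat.
by case: ltnP => // si; rewrite nth_nseq if_same nth_default.
Qed.

Lemma ssn_mkseq_nth (R : realType) (N : seq R -> R) (HN : subsym_norm N) s n :
  (size s <= n)%N -> N (mkseq (nth 0 s) n) = N s.
Proof. by move=> sn; rewrite mkseq_nth_pad// (ssn_nseq0 HN). Qed.

Lemma zipadd_mkseq (R : realType) (f g : nat -> R) n :
  zipadd (mkseq f n) (mkseq g n) = mkseq (fun i => f i + g i) n.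
Proof.
by rewrite /zipadd /mkseq; elim: (iota 0 n) => //= i l ->.
Qed.

(* [{poly R}] serves as the space of finitely supported sequences. *)
Definition ssn_space (R : realType) (N : seq R -> R) (HN : subsym_norm N) : Type :=
  {poly R}.

Section SsnSpace.
Variables (R : realType) (N : seq R -> R) (HN : subsym_norm N).

HB.instance Definition _ := GRing.Lmodule.copy (ssn_space HN) {poly R}.

Let norm (u : ssn_space HN) : R := N (u : {poly R}).

Let norm_add (u v : ssn_space HN) : norm (u + v) <= norm u + norm v.
Proof.
rewrite /norm; pose n := maxn (size (u : {poly R})) (size (v : {poly R})).
rewrite -(@ssn_mkseq_nth _ _ HN (u : {poly R}) n) ?leq_maxl//.
rewrite -(@ssn_mkseq_nth _ _ HN (v : {poly R}) n) ?leq_maxr//.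
rewrite -(@ssn_mkseq_nth _ _ HN ((u + v)%R : {poly R}) n); last exact: size_polyD.
have -> : mkseq (nth 0 ((u + v)%R : {poly R})) n =
    zipadd (mkseq (nth 0 (u : {poly R})) n) (mkseq (nth 0 (v : {poly R})) n).
  by rewrite zipadd_mkseq; apply: eq_mkseq => i; exact: coefD.
by apply: (ssn_zipadd HN); rewrite !size_mkseq.
Qed.

Let norm_scale (c : R) (u : ssn_space HN) : norm (c *: u) = `|c| * norm u.
Proof.
rewrite /norm; pose n := size (u : {poly R}).
rewrite -(@ssn_mkseq_nth _ _ HN (u : {poly R}) n)//.
rewrite -(@ssn_mkseq_nth _ _ HN ((c *: u)%R : {poly R}) n); last exact: size_scale_leq.
rewrite -(ssn_scale HN) /mkseq -map_comp; congr N.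
by apply: eq_map => i /=; exact: coefZ.
Qed.

Let norm_eq0 (u : ssn_space HN) : norm u = 0 -> u = 0.
Proof.
rewrite /norm => u0; apply/eqP; apply/negP => /negP uN0.
have : lead_coef (u : {poly R}) != 0 by rewrite lead_coef_eq0.
rewrite -normr_gt0 ltNge => /negP; apply; rewrite -u0.
apply: (ssn_ge_mem HN); rewrite lead_coefE mem_nth//.
by rewrite prednK ?size_poly_gt0.
Qed.

HB.instance Definition _ :=
  Lmodule_isNormed.Build R (ssn_space HN) norm_add norm_scale norm_eq0.

Lemma ssn_space_normE (u : ssn_space HN) : `|u| = N (u : {poly R}).
Proof. by []. Qed.

Definition ssn_model : smodel R :=
  @SModel R (ssn_space HN) (fun i => 'X^i : {poly R}).

Lemma cnorm_ssn_model a n : cnorm ssn_model a n = N (mkseq a n).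
Proof.
rewrite /cnorm /=; have -> : \sum_(i < n) a i *: ('X^i : ssn_space HN) =
    (\poly_(i < n) a i : {poly R}) by rewrite poly_def.
rewrite ssn_space_normE -(@ssn_mkseq_nth _ _ HN _ n) ?size_poly//.
congr N; apply: (@eq_from_nth _ 0); rewrite !size_mkseq// => i ilt.
by rewrite !nth_mkseq// coef_poly ilt.
Qed.

End SsnSpace.

(** * Tensor products of coefficient sequences *)

Lemma tensor_cons (R : realType) a (s t : seq R) :
  tensor (a :: s) t = [seq a * b | b <- t] ++ tensor s t.
Proof. by []. Qed.

Lemma size_tensor (R : realType) (s t : seq R) :
  size (tensor s t) = (size s * size t)%N.
Proof. exact: size_allpairs. Qed.

Lemma tensor_cat (R : realType) (s s' t : seq R) :
  tensor (s ++ s') t = tensor s t ++ tensor s' t.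
Proof. by elim: s => //= a s IH; rewrite !tensor_cons IH catA. Qed.

Lemma zipadd_cat (R : realType) (s1 s2 t1 t2 : seq R) : size s1 = size t1 ->
  zipadd (s1 ++ s2) (t1 ++ t2) = zipadd s1 t1 ++ zipadd s2 t2.
Proof. by move=> sz; rewrite /zipadd zip_cat// map_cat. Qed.

Lemma tensor_zipaddl (R : realType) (s s' t : seq R) : size s = size s' ->
  tensor (zipadd s s') t = zipadd (tensor s t) (tensor s' t).
Proof.
elim: s s' => [|a s IH] [|b s'] // [sz].
rewrite !tensor_cons zipadd_cat ?size_map// -IH//.
congr (_ ++ _).
by elim: t {IH} => //= c t ->; rewrite /= mulrDl.
Qed.

Lemma tensor_zipaddr (R : realType) (s t t' : seq R) : size t = size t' ->
  tensor s (zipadd t t') = zipadd (tensor s t) (tensor s t').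
Proof.
move=> sz; elim: s => [|a s IH] //.
rewrite !tensor_cons zipadd_cat ?size_map// -IH; congr (_ ++ _).
elim: t t' sz {IH} => [|c t IH] [|c' t'] //= [sz].
by rewrite /zipadd /= -!/(zipadd _ _) IH// mulrDr.
Qed.

Lemma tensor_subseq (R : realType) (s t t' : seq R) :
  subseq t t' -> subseq (tensor s t) (tensor s t').
Proof.
by move=> tt'; elim: s => [|a s IH]//; rewrite !tensor_cons cat_subseq ?map_subseq.
Qed.

Lemma tensor_scaler (R : realType) (c : R) (s t : seq R) :
  tensor s [seq c * x | x <- t] = [seq c * x | x <- tensor s t].
Proof.
elim: s => //= a s IH; rewrite !tensor_cons map_cat IH -!map_comp; congr (_ ++ _).
by apply: eq_map => x /=; rewrite mulrCA.
Qed.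

Lemma tensor_scalel (R : realType) (c : R) (s t : seq R) :
  tensor [seq c * x | x <- s] t = [seq c * x | x <- tensor s t].
Proof.
elim: s => //= a s IH; rewrite !tensor_cons map_cat IH -!map_comp; congr (_ ++ _).
by apply: eq_map => x /=; rewrite mulrA.
Qed.

Section TensorNorm.
Variables (R : realType) (N : seq R -> R) (HN : subsym_norm N).

Lemma ssn_tensor_le s t : N (tensor s t) <= (\sum_(a <- s) `|a|) * N t.
Proof.
elim: s => [|a s IH]; first by rewrite big_nil mul0r (ssn_nil HN).
rewrite tensor_cons big_cons mulrDl; apply: (le_trans (ssn_cat HN _ _)).
by rewrite lerD// (ssn_scale HN).
Qed.

(** The parts coming from [t] and [t'] interleave in the lexicographic order, so [ssn_cat] does not
    apply. Both are padded with zeros to a common length, added, and stripped of zeros again. *)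
Lemma ssn_tensor_catr s t t' :
  N (tensor s (t ++ t')) <= N (tensor s t) + N (tensor s t').
Proof.
have {1}-> : t ++ t' = zipadd (t ++ nseq (size t') 0) (nseq (size t) 0 ++ t').
  rewrite zipadd_cat ?size_nseq//; congr (_ ++ _).
    by elim: t => //= x t {1}->; rewrite /zipadd /= addr0.
  by elim: t' => //= x t' {1}->; rewrite /zipadd /= add0r.
rewrite tensor_zipaddr; last by rewrite !size_cat !size_nseq.
apply: (le_trans (ssn_zipadd HN _)).
  by rewrite !size_tensor !size_cat !size_nseq.
have z a n : [seq x <- [seq a * b | b <- nseq n 0] | x != 0] = [::] :> seq R.
  by elim: n => //= n ->; rewrite mulr0 eqxx.
rewrite -(ssn_filter0 HN) -(ssn_filter0 HN (tensor s (nseq _ _ ++ _))).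
rewrite -(ssn_filter0 HN (tensor s t)) -(ssn_filter0 HN (tensor s t')).
have -> : [seq x <- tensor s (t ++ nseq (size t') 0) | x != 0] =
    [seq x <- tensor s t | x != 0].
  by elim: s => // a s IH; rewrite !tensor_cons !filter_cat IH map_cat filter_cat z cats0.
have -> // : [seq x <- tensor s (nseq (size t) 0 ++ t') | x != 0] =
    [seq x <- tensor s t' | x != 0].
by elim: s => // a s IH; rewrite !tensor_cons !filter_cat IH map_cat filter_cat z.
Qed.

Lemma ssn_tensor_insert0 s s' t :
  N (tensor (s ++ 0 :: s') t) = N (tensor (s ++ s') t).
Proof.
rewrite -(ssn_filter0 HN) -(ssn_filter0 HN (tensor (s ++ s') t)).
rewrite !tensor_cat tensor_cons !filter_cat.
have -> // : [seq x <- [seq 0 * b | b <- t] | x != 0] = [::].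
by elim: t => //= x t ->; rewrite mul0r eqxx.
Qed.

Lemma ssn_tensor_suppress c s s' t :
  N (tensor (s ++ s') t) <= N (tensor (s ++ c :: s') t).
Proof.
apply: (ssn_subseq HN); rewrite !tensor_cat tensor_cons cat_subseq//.
exact: suffix_subseq.
Qed.

End TensorNorm.

Lemma mkseqD (T : Type) (f : nat -> T) m n :
  mkseq f (m + n) = mkseq f m ++ mkseq (fun i => f (m + i)%N) n.
Proof. by rewrite /mkseq iotaD map_cat add0n -{2}[m]addn0 iotaDl -map_comp. Qed.

(** * The norm obtained by replacing unit vectors with copies of [beta] *)

Section BlockNorm.
Variables (R : realType) (N : seq R -> R) (HN : subsym_norm N) (beta : nat -> R).
Hypothesis tail : forall d, 0 < d -> exists Q, forall k,
  N (mkseq (fun q => beta (Q + q)%N) k) <= d.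
Hypothesis beta0 : beta 0%N != 0.

Let b Q := mkseq beta Q.

Lemma block_prefix_subseq Q Q' : (Q <= Q')%N -> subseq (b Q) (b Q').
Proof. by move=> QQ; rewrite /b -(subnKC QQ) mkseqD prefix_subseq. Qed.

Lemma block_prefix_bounded : exists B, forall Q, N (b Q) <= B.
Proof.
have [Q0 HQ] := tail ltr01; exists (N (b Q0) + 1) => Q.
have [QQ|QQ] := leqP Q Q0.
  by rewrite -[leLHS]addr0 lerD// (ssn_subseq HN) ?block_prefix_subseq.
rewrite /b -(subnKC (ltnW QQ)) mkseqD; apply: (le_trans (ssn_cat HN _ _)).
by rewrite lerD2l.
Qed.

(** The norm of [s (x) beta] for the infinite sequence [beta]. Norms increase along the prefixes by
    suppression, so the supremum is a limit; small tails of [beta] make it finite. *)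
Definition block_sup s := sup (range (fun Q => N (tensor s (b Q)))).

Let sum_abs (s : seq R) := \sum_(a <- s) `|a|.

Let sum_abs_ge0 s : 0 <= sum_abs s. Proof. exact: sumr_ge0. Qed.

Let hs s : has_sup (range (fun Q => N (tensor s (b Q)))).
Proof.
have [B HB] := block_prefix_bounded; split; first by exists (N (tensor s (b 0))); exists 0%N.
exists (sum_abs s * B) => _ [Q _ <-]; apply: (le_trans (ssn_tensor_le HN _ _)).
by apply: ler_wpM2l; [exact: sum_abs_ge0|exact: HB].
Qed.

Lemma block_sup_ge s Q : N (tensor s (b Q)) <= block_sup s.
Proof. by apply: (sup_ubound (proj2 (hs s))); exists Q. Qed.

Lemma block_sup_le s c : (forall Q, N (tensor s (b Q)) <= c) -> block_sup s <= c.
Proof. by move=> H; apply: ge_sup => [|_ [Q _ <-]]; [exact: (proj1 (hs s))|]. Qed.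

Lemma block_sup_ge0 s : 0 <= block_sup s.
Proof. exact: le_trans (ssn_ge0 HN _) (block_sup_ge s 0). Qed.

Lemma block_sup_approx s d Q : (forall k, N (mkseq (fun q => beta (Q + q)%N) k) <= d) ->
  block_sup s <= N (tensor s (b Q)) + sum_abs s * d.
Proof.
move=> HQ; apply: block_sup_le => Q'.
have d0 : 0 <= d by apply: le_trans (HQ 0%N); exact: ssn_ge0.
have [QQ|QQ] := leqP Q' Q.
  rewrite -[leLHS]addr0 lerD ?(mulr_ge0 (sum_abs_ge0 s) d0)// (ssn_subseq HN)//.
  by rewrite tensor_subseq// block_prefix_subseq.
rewrite /b -(subnKC (ltnW QQ)) mkseqD; apply: (le_trans (ssn_tensor_catr HN _ _ _)).
rewrite lerD2l; apply: (le_trans (ssn_tensor_le HN _ _)).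
by apply: ler_wpM2l; [exact: sum_abs_ge0|exact: HQ].
Qed.

Lemma tensor1l (t : seq R) : tensor [:: 1] t = t.
Proof.
rewrite tensor_cons /= cats0 -[RHS]map_id; apply: eq_map => x.
by rewrite mul1r.
Qed.

Definition block_unit := block_sup [:: 1].

Lemma block_unit_gt0 : 0 < block_unit.
Proof.
apply: lt_le_trans (block_sup_ge _ 1); rewrite tensor1l.
by rewrite /b /= (ssn_singleton HN) normr_gt0.
Qed.

Definition block_norm s := block_unit^-1 * block_sup s.

Lemma block_sup_scale_le c s :
  block_sup [seq c * x | x <- s] <= `|c| * block_sup s.
Proof.
apply: block_sup_le => Q; rewrite tensor_scalel (ssn_scale HN) ler_wpM2l//.
exact: block_sup_ge.
Qed.

(** The axioms pass from [N] to the supremum over prefixes. Having them before any spreading model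
    is exhibited is what allows [ssn_model] to supply a normed space with this coefficient norm. *)
Lemma block_norm_ssn : subsym_norm block_norm.
Proof.
have u0 := block_unit_gt0.
have ui : 0 < block_unit^-1 by rewrite invr_gt0.
split.
- move=> s t; congr (_ * _); apply/eqP; rewrite eq_le; apply/andP; split;
    apply: block_sup_le => Q.
    by rewrite (ssn_tensor_insert0 HN) block_sup_ge.
  by rewrite -(ssn_tensor_insert0 HN) block_sup_ge.
- move=> c s t; rewrite ler_pM2l//; apply: block_sup_le => Q.
  by apply: le_trans (block_sup_ge _ Q); exact: ssn_tensor_suppress.
- move=> c s; rewrite /block_norm mulrCA; congr (_ * _).
  apply/eqP; rewrite eq_le block_sup_scale_le /=.
  have [->|c0] := eqVneq c 0; first by rewrite normr0 mul0r block_sup_ge0.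
  have {1}-> : s = [seq c^-1 * x | x <- [seq c * x | x <- s]].
    rewrite -map_comp -[LHS]map_id; apply: eq_map => x /=.
    by rewrite mulrA mulVf// mul1r.
  by rewrite -ler_pdivlMl ?normr_gt0// -normfV block_sup_scale_le.
- move=> s t sz; rewrite -mulrDr ler_pM2l//; apply: block_sup_le => Q.
  rewrite tensor_zipaddl//; apply: (le_trans (ssn_zipadd HN _)).
    by rewrite !size_tensor sz.
  by rewrite lerD// block_sup_ge.
- by rewrite /block_norm -/block_unit mulVf// gt_eqF.
Qed.

End BlockNorm.

Section LcombMore.
Variables (R : realType) (V : lmodType R).

Lemma eq_in_lcomb (x y : nat -> V) ks (s : seq R) : {in ks, x =1 y} ->
  lcomb x ks s = lcomb y ks s.
Proof.
elim: ks s => [|k ks IH] [|a s] H; rewrite ?lcomb_nil ?lcomb_nil_r// !lcomb_cons.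
by rewrite H ?mem_head// IH// => i ik; apply: H; rewrite inE ik orbT.
Qed.

Lemma lcombD (x y : nat -> V) ks (s : seq R) :
  lcomb (fun i => x i + y i) ks s = lcomb x ks s + lcomb y ks s.
Proof.
by rewrite /lcomb -big_split; apply: eq_bigr => p _; rewrite scalerDr.
Qed.

Lemma lcombZ c (x : nat -> V) ks (s : seq R) :
  lcomb (fun i => c *: x i) ks s = c *: lcomb x ks s.
Proof.
rewrite /lcomb scaler_sumr; apply: eq_bigr => p _.
by rewrite !scalerA mulrC.
Qed.

(** The inner combinations must share the length of [t], which is why the blocks are later cut to
    heads of fixed length. *)
Lemma lcomb_lcomb (x : nat -> V) (J : nat -> seq nat) ks (s t : seq R) :
  (forall k, size (J k) = size t) -> size ks = size s ->
  lcomb (fun k => lcomb x (J k) t) ks s =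
  lcomb x (flatten [seq J k | k <- ks]) (tensor s t).
Proof.
move=> HJ; elim: ks s => [|k ks IH] [|a s] //=; first by rewrite !lcomb_nil.
move=> [sz]; rewrite tensor_cons lcomb_cons lcomb_cat ?size_map// IH//.
by rewrite lcomb_scale.
Qed.

End LcombMore.

Lemma sum_abs_le_size (R : realType) (s : seq R) :
  all (fun a => `|a| <= 1) s -> \sum_(a <- s) `|a| <= (size s)%:R.
Proof.
elim: s => [|a s IH] /=; first by rewrite big_nil.
by move=> /andP[a1 /IH h]; rewrite big_cons -add1n natrD lerD.
Qed.

Lemma functional_lcomb_le (R : realType) (V : lmodType R) (D : V -> Prop)
    (nrm : V -> R) (f : V -> R) (x : nat -> V) ks s B :
  normed_on D nrm -> (forall n, D (x n)) ->
  (forall c u v, D u -> D v -> f (c *: u + v) = c * f u + f v) ->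
  all (fun k => `|f (x k)| <= B) ks -> size ks = size s ->
  `|f (lcomb x ks s)| <= (\sum_(a <- s) `|a|) * B.
Proof.
move=> HZ Dx lf; elim: ks s => [|k ks IH] [|a s] //=.
  rewrite lcomb_nil big_nil mul0r => _ _.
  have := lf (-1) 0 0 (no_D0 HZ) (no_D0 HZ).
  by rewrite scaleN1r oppr0 addr0 mulN1r addNr => ->; rewrite normr0.
move=> /andP[kB ksB] [sz]; rewrite lcomb_cons lf//; last exact: (no_D_lcomb HZ _ _ Dx).
rewrite big_cons mulrDl; apply: (le_trans (ler_normD _ _)).
by rewrite lerD ?IH// normrM ler_wpM2l.
Qed.

Lemma leq_square k : (k <= k ^ 2)%N.
Proof. by rewrite -mulnn; case: k => // k; rewrite leq_pmulr. Qed.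

Lemma square_gap i j : (i < j)%N -> (i ^ 2 + i < j ^ 2)%N.
Proof.
move=> ij; apply: (@leq_trans (i.+1 ^ 2)); last by rewrite leq_exp2r.
by rewrite -[i.+1]addn1 sqrnD; lia.
Qed.

(** * Block vectors with coefficients [beta] *)

Section BlockSequence.
Variables (R : realType) (V : lmodType R) (D : V -> Prop) (nrm : V -> R).
Hypothesis HZ : normed_on D nrm.
Variables (x : nat -> V) (S : smodel R).
Hypothesis xnorm : normalized nrm x.
Hypothesis xnull : wnull D nrm x.
Hypothesis gen : generates_sm nrm x (@sm_seq _ S).

Let Dx : forall n, D (x n) := proj1 xnull.
Let N := sm_norm S.
Let HN : subsym_norm N := sm_norm_ssn HZ xnorm xnull gen.

Variable beta : nat -> R.
Hypothesis tail : forall d, 0 < d -> exists Q, forall k,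
  N (mkseq (fun q => beta (Q + q)%N) k) <= d.
Hypothesis beta0 : beta 0%N != 0.

Let P := block_sup N beta.
Let nu := block_unit N beta.
Let M := block_norm N beta.
Let HM : subsym_norm M := block_norm_ssn HN tail beta0.
Let nu0 : 0 < nu := block_unit_gt0 HN tail beta0.

(* The blocks [[i ^ 2, i ^ 2 + i)] are disjoint and start late enough for the
   spreading model estimates to apply to each of them. *)
Definition block_vec i := lcomb x (iota (i ^ 2) i) (mkseq beta i).

Let u := block_vec.

Lemma block_vec_D i : D (u i). Proof. exact: (no_D_lcomb HZ _ _ Dx). Qed.

(** Heads have the same [Q] coefficients for all [i], so their combinations are governed by tensor
    products; the rests are small in norm uniformly in [i], because the tails of [beta] are. *)
Let head Q i := lcomb x (iota (i ^ 2) Q) (mkseq beta Q).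
Let rest Q i := lcomb x (iota (i ^ 2 + Q) (i - Q)) (mkseq (fun q => beta (Q + q)%N) (i - Q)).

Let D_head Q i : D (head Q i). Proof. exact: (no_D_lcomb HZ _ _ Dx). Qed.
Let D_rest Q i : D (rest Q i). Proof. exact: (no_D_lcomb HZ _ _ Dx). Qed.

Let u_split Q i : (Q <= i)%N -> u i = head Q i + rest Q i.
Proof.
move=> Qi; rewrite /u /block_vec.
have -> : iota (i ^ 2) i = iota (i ^ 2) Q ++ iota (i ^ 2 + Q) (i - Q).
  by rewrite -iotaD subnKC.
have -> : mkseq beta i = mkseq beta Q ++ mkseq (fun q => beta (Q + q)%N) (i - Q).
  by rewrite -mkseqD subnKC.
by rewrite lcomb_cat// size_iota size_mkseq.
Qed.

Let rest_small : exists2 E : R, 0 < E & forall Q d,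
  (forall k, N (mkseq (fun q => beta (Q + q)%N) k) <= d) ->
  forall i, nrm (rest Q i) <= E * d.
Proof.
have [E E0 HE] := generates_upper HZ Dx gen; exists E => // Q d HQ i.
apply: (@le_trans _ _ (E * N (mkseq (fun q => beta (Q + q)%N) (i - Q)))).
  apply: HE; rewrite ?size_iota ?size_mkseq//; first exact: iota_ltn_sorted.
  by apply/allP => j; rewrite mem_iota => /andP[h _]; have := leq_square i; lia.
by rewrite ler_pM2l.
Qed.

Lemma square_blocks_sorted Q ks : sorted ltn ks -> all (leq Q) ks ->
  sorted ltn (flatten [seq iota (k ^ 2) Q | k <- ks]).
Proof.
elim: ks => //= k ks IH pk /andP[Qk Qks].
rewrite sorted_ltn_cat iota_ltn_sorted IH ?(path_sorted pk)//= andbT.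
apply/allrelP => i j; rewrite mem_iota => /andP[_ i2] /flatten_mapP[k' k'ks].
rewrite mem_iota => /andP[j1 _].
have /allP/(_ _ k'ks) /= kk := order_path_min ltn_trans pk.
by have := square_gap kk; lia.
Qed.

(** Three errors add up: dropping the rests, replacing the norm of the combined heads by
    [N (tensor s (mkseq beta Q))], and replacing the prefix of [beta] by all of it. *)
Lemma block_vec_asymptotic m d : 0 < d -> exists J, forall ks s,
  size ks = m -> size s = m -> sorted ltn ks -> all (leq J) ks ->
  all (fun a => `|a| <= 1) s -> `|nrm (lcomb u ks s) - P s| <= d.
Proof.
move=> d0; have [E E0 HE] := rest_small.
have [B HB] := block_prefix_bounded HN tail.
have B0 : 0 <= B by apply: le_trans (HB 0%N); exact: ssn_ge0 HN _.
have m0 : 0 <= m%:R :> R by [].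
(* This [e] makes the first and third errors together at most [d / 2]; [h] below does so for the
   second, which is relative to [N t <= m * B]. *)
pose e := d / (2 * (m%:R * E + m%:R + 1)).
have c0 : 0 < 2 * (m%:R * E + m%:R + 1).
  by rewrite mulr_gt0// ltr_wpDl// addr_ge0// mulr_ge0// ltW.
have e0 : 0 < e by rewrite divr_gt0.
have eE : e * (2 * (m%:R * E + m%:R + 1)) = d by rewrite /e divfK// gt_eqF.
pose h := d / (2 * (m%:R * B + 1)).
have c1 : 0 < 2 * (m%:R * B + 1) by rewrite mulr_gt0// ltr_wpDl// mulr_ge0.
have h0 : 0 < h by rewrite divr_gt0.
have hE : h * (2 * (m%:R * B + 1)) = d by rewrite /h divfK// gt_eqF.
have [Q HQ] := tail e0.
have [J HJ] := generates_asymptotic HZ Dx gen (m * Q) h0.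
exists (maxn J Q) => ks s szk szs srt ksJ s1.
have ksQ : all (leq Q) ks.
  by apply: sub_all ksJ => k /=; rewrite geq_max => /andP[].
have ksJ' : all (leq J) ks.
  by apply: sub_all ksJ => k /=; rewrite geq_max => /andP[].
have sums : \sum_(a <- s) `|a| <= m%:R by rewrite -szs; exact: sum_abs_le_size.
have sums0 : 0 <= \sum_(a <- s) `|a| by exact: sumr_ge0.
pose t := tensor s (mkseq beta Q).
pose ls := flatten [seq iota (k ^ 2) Q | k <- ks].
have uE : lcomb u ks s = lcomb x ls t + lcomb (rest Q) ks s.
  have -> : lcomb u ks s = lcomb (fun i => head Q i + rest Q i) ks s.
    by apply: eq_in_lcomb => i ik; apply: u_split; exact: (allP ksQ).
  rewrite lcombD; congr (_ + _); apply: lcomb_lcomb; last by rewrite szk.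
  by move=> k; rewrite size_iota size_mkseq.
have a1 : nrm (lcomb (rest Q) ks s) <= m%:R * (E * e).
  apply: (@le_trans _ _ ((\sum_(a <- s) `|a|) * (E * e))).
    apply: (no_lcomb_le HZ); rewrite ?szk//.
    by apply/allP => k _; exact: HE.
  by rewrite ler_wpM2r// mulr_ge0// ltW.
have Nt : N t <= m%:R * B.
  apply: (le_trans (ssn_tensor_le HN _ _)); apply: ler_pM => //; exact: (ssn_ge0 HN).
have Nt0 : 0 <= N t by exact: ssn_ge0 HN _.
have szt : size t = (m * Q)%N by rewrite size_tensor size_mkseq szs.
have szl : size ls = (m * Q)%N.
  rewrite /ls -szk; elim: (ks) => //= k l IH.
  by rewrite size_cat size_iota IH mulSn.
have a2 : `|nrm (lcomb x ls t) - N t| <= h * (m%:R * B).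
  apply: (@le_trans _ _ (h * N t)); last by rewrite ler_pM2l.
  apply: HJ => //; first exact: square_blocks_sorted.
  apply/allP => j /flatten_mapP[k kks]; rewrite mem_iota => /andP[kj _].
  exact: leq_trans (allP ksJ' _ kks) (leq_trans (leq_square k) kj).
have a3 : `|N t - P s| <= m%:R * e.
  have := block_sup_approx HN tail s HQ; rewrite -/P -/t => a3.
  have := block_sup_ge HN tail s Q; rewrite -/P -/t => a4.
  have : (\sum_(a <- s) `|a|) * e <= m%:R * e by rewrite ler_pM2r.
  by rewrite ler_norml => ?; apply/andP; split; lra.
have Dr : D (lcomb (rest Q) ks s) by exact: (no_D_lcomb HZ _ _ (D_rest Q)).
have Dl : D (lcomb x ls t) by exact: (no_D_lcomb HZ _ _ Dx).
have a5 : `|nrm (lcomb u ks s) - nrm (lcomb x ls t)| <= m%:R * (E * e).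
  rewrite uE; apply: le_trans a1.
  have := no_sub_norm HZ (no_D_add HZ Dl Dr) Dl.
  by rewrite addrAC subrr add0r.
have -> : nrm (lcomb u ks s) - P s = (nrm (lcomb u ks s) - nrm (lcomb x ls t)) +
   (nrm (lcomb x ls t) - N t) + (N t - P s) by ring.
apply: (le_trans (ler_normD _ _)); apply: (le_trans (lerD (ler_normD _ _) (lexx _))).
move: eE hE; lra.
Qed.

Lemma block_vec_nrm d : 0 < d -> exists J, forall i, (J <= i)%N -> `|nrm (u i) - nu| <= d.
Proof.
move=> d0; have [J HJ] := block_vec_asymptotic 1 d0; exists J => i Ji.
have := HJ [:: i] [:: 1] erefl erefl erefl; rewrite /= Ji normr1 lexx => /(_ isT isT).
by rewrite lcomb_cons lcomb_nil addr0 scale1r.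
Qed.

Definition block_seq i := (nrm (u i))^-1 *: u i.

Let y := block_seq.

Let D_y i : D (y i). Proof. by apply: (no_D_scale HZ); exact: block_vec_D. Qed.

Lemma block_seq_abs m d : 0 < d -> exists J, forall ks s,
  size ks = m -> size s = m -> sorted ltn ks -> all (leq J) ks ->
  all (fun a => `|a| <= 1) s -> `|nrm (lcomb y ks s) - M s| <= d.
Proof.
move=> d0; have m0 : 0 <= m%:R :> R by [].
have d1 : 0 < nu * (d / 2) by rewrite mulr_gt0// divr_gt0.
have [J1 H1] := block_vec_asymptotic m d1.
pose e := d / (2 * (m%:R + 1)).
have c0 : 0 < 2 * (m%:R + 1) :> R by rewrite mulr_gt0// ltr_wpDl.
have e0 : 0 < e by rewrite divr_gt0.
have eE : e * (2 * (m%:R + 1)) = d by rewrite /e divfK// gt_eqF.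
have [J2 H2] := block_vec_nrm (mulr_gt0 e0 nu0).
have nu2 : 0 < nu / 2 by rewrite divr_gt0.
have [J3 H3] := block_vec_nrm nu2.
exists (maxn J1 (maxn J2 J3)) => ks s szk szs srt ksJ s1.
have all3 i : i \in ks -> [/\ (J1 <= i)%N, (J2 <= i)%N & (J3 <= i)%N].
  by move=> /(allP ksJ) /=; rewrite !geq_max => /and3P[].
pose z i := y i - nu^-1 *: u i.
have yE : lcomb y ks s = nu^-1 *: lcomb u ks s + lcomb z ks s.
  rewrite -lcombZ -lcombD; apply: eq_in_lcomb => i _.
  by rewrite /z addrCA subrr addr0.
have Dz i : D (z i).
  by apply: (no_D_sub HZ) => //; apply: (no_D_scale HZ); exact: block_vec_D.
have a1 : nrm (lcomb z ks s) <= m%:R * e.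
  apply: (@le_trans _ _ ((\sum_(a <- s) `|a|) * e)); last first.
    by rewrite ler_pM2r// -szs; exact: sum_abs_le_size.
  apply: (no_lcomb_le HZ); rewrite ?szk//.
  apply/allP => i ik; have [_ i2 i3] := all3 _ ik.
  have h2 := H2 i i2; have h3 := H3 i i3.
  have un0 : 0 < nrm (u i) by move: h3; rewrite ler_norml => /andP[? _]; lra.
  rewrite /z /y /block_seq -scalerBl (no_scale HZ) ?block_vec_D//; last exact: block_vec_D.
  rewrite -[X in _ * X](gtr0_norm un0) -normrM.
  have -> : ((nrm (u i))^-1 - nu^-1) * nrm (u i) = - ((nrm (u i) - nu) / nu).
    by field; rewrite !gt_eqF.
  by rewrite normrN normrM normfV (gtr0_norm nu0) ler_pdivrMr.
have a2 : `|nu^-1 * nrm (lcomb u ks s) - M s| <= d / 2.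
  rewrite /M /block_norm -mulrBr normrM gtr0_norm ?invr_gt0// ler_pdivrMl//.
  apply: H1 => //; apply/allP => i /all3 [] //.
have Du : D (lcomb u ks s) by exact: (no_D_lcomb HZ _ _ block_vec_D).
have Dz' : D (lcomb z ks s) by exact: (no_D_lcomb HZ _ _ Dz).
have a3 : `|nrm (lcomb y ks s) - nu^-1 * nrm (lcomb u ks s)| <= m%:R * e.
  apply: le_trans a1.
  have -> : nu^-1 * nrm (lcomb u ks s) = nrm (nu^-1 *: lcomb u ks s).
    by rewrite (no_scale HZ)// gtr0_norm// invr_gt0.
  have := no_sub_norm HZ (no_D_add HZ (no_D_scale HZ nu^-1 Du) Dz') (no_D_scale HZ nu^-1 Du).
  by rewrite yE addrAC subrr add0r.
have -> : nrm (lcomb y ks s) - M s = (nrm (lcomb y ks s) - nu^-1 * nrm (lcomb u ks s))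
  + (nu^-1 * nrm (lcomb u ks s) - M s) by ring.
apply: (le_trans (ler_normD _ _)); move: eE; lra.
Qed.

(** Scaling to [M s = 1] turns the absolute error into a relative one, and suppression then bounds
    the coefficients by 1. *)
Lemma block_seq_asymptotic : asymptotic_norm nrm y M.
Proof.
move=> m d d0; have [J HJ] := block_seq_abs m d0; exists J => ks s szk szs srt ksJ.
have [Ms|Ms] := eqVneq (M s) 0.
  have -> : s = [seq 0 * a | a <- s].
    rewrite -[LHS]map_id; apply/eq_in_map => a sa; rewrite mul0r.
    by apply/eqP; rewrite -normr_le0 -Ms (ssn_ge_mem HM).
  rewrite lcomb_scale scale0r (no_nrm0 HZ) (ssn_scale HM) normr0 mul0r subrr normr0.
  by rewrite mulr0.
have M0 : 0 < M s by rewrite lt_neqAle eq_sym Ms (ssn_ge0 HM).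
have := HJ ks [seq (M s)^-1 * a | a <- s] szk; rewrite size_map => /(_ szs srt ksJ).
rewrite lcomb_scale (ssn_scale HM) (no_scale HZ); last exact: (no_D_lcomb HZ _ _ D_y).
have ni : `|(M s)^-1| = (M s)^-1 by rewrite gtr0_norm ?invr_gt0.
rewrite ni -mulrBr normrM ni ler_pdivrMl// [M s * d]mulrC; apply.
apply/allP => _ /mapP[a sa ->]; rewrite normrM gtr0_norm ?invr_gt0//.
by rewrite ler_pdivrMl// mulr1 (ssn_ge_mem HM).
Qed.

(** A head combines a fixed number of vectors [x k] with [k >= i ^ 2], so weak nullity makes [f]
    small on it; on the rest the bound of [f] suffices. *)
Lemma block_vec_null f e : bounded_functional D nrm f -> 0 < e ->
  exists J, forall i, (J <= i)%N -> `|f (u i)| <= e.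
Proof.
move=> bf e0; have [lf [C HC]] := bf.
have [E E0 HE] := rest_small.
have C1 : 0 < `|C| + 1 by rewrite ltr_wpDl.
pose d := e / (2 * ((`|C| + 1) * E)).
have c0 : 0 < 2 * ((`|C| + 1) * E) by rewrite !mulr_gt0.
have d0 : 0 < d by rewrite divr_gt0.
have dE : d * (2 * ((`|C| + 1) * E)) = e by rewrite /d divfK// gt_eqF.
have [Q HQ] := tail d0.
pose A := \sum_(a <- mkseq beta Q) `|a|.
have A0 : 0 <= A by exact: sumr_ge0.
pose h := e / (2 * (A + 1)).
have c1 : 0 < 2 * (A + 1) by rewrite mulr_gt0// ltr_wpDl.
have h0 : 0 < h by rewrite divr_gt0.
have hE : h * (2 * (A + 1)) = e by rewrite /h divfK// gt_eqF.
have /cvgrPdist_le/(_ h h0)[J _ HJ] := proj2 xnull f bf.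
exists (maxn J Q) => i; rewrite geq_max => /andP[Ji Qi].
rewrite (u_split Qi) -[head Q i]scale1r lf// mul1r.
have a1 : `|f (head Q i)| <= A * h.
  rewrite /head /A; apply: (functional_lcomb_le HZ Dx lf); last by rewrite size_iota size_mkseq.
  apply/allP => k; rewrite mem_iota => /andP[ik _].
  have /= := HJ k; rewrite sub0r normrN; apply => /=.
  exact: leq_trans Ji (leq_trans (leq_square i) ik).
have a2 : `|f (rest Q i)| <= (`|C| + 1) * (E * d).
  apply: (le_trans (HC _ (D_rest Q i))).
  apply: (@le_trans _ _ ((`|C| + 1) * nrm (rest Q i))).
    rewrite ler_wpM2r//; first exact: (no_nrm_ge0 HZ).
    by have := ler_norm C; lra.
  by rewrite ler_pM2l// HE.
apply: (le_trans (ler_normD _ _)).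
move: dE hE; lra.
Qed.

(** Early blocks may vanish, as [u 0] does, so normalization makes sense only from some index on. *)
Lemma block_seq_pos : exists J, forall i, (J <= i)%N -> nu / 2 <= nrm (u i).
Proof.
have nu2 : 0 < nu / 2 by rewrite divr_gt0.
have [J H] := block_vec_nrm nu2; exists J => i /H.
by rewrite ler_norml => /andP[? _]; lra.
Qed.

Lemma block_seq_null (g : nat -> nat) :
  (forall i, (g i < g i.+1)%N) -> wnull D nrm (fun i => y (g i)).
Proof.
move=> gS; split=> // f bf.
have gi i : (i <= g i)%N by elim: i => // i IH; exact: leq_ltn_trans IH (gS i).
have [J1 H1] := block_seq_pos.
apply/cvgrPdist_le => e e0.
have e1 : 0 < e * (nu / 2) by rewrite mulr_gt0// divr_gt0.
have [J2 H2] := block_vec_null bf e1.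
exists (maxn J1 J2) => // i /=; rewrite geq_max => /andP[h1 h2].
have {}h1 := H1 _ (leq_trans h1 (gi i)); have {}h2 := H2 _ (leq_trans h2 (gi i)).
have [lf _] := bf.
have f0 : f 0 = 0.
  by have := lf (-1) 0 0 (no_D0 HZ) (no_D0 HZ);
     rewrite scaleN1r oppr0 addr0 mulN1r addNr.
rewrite sub0r normrN /y /block_seq -[_ *: _]addr0 lf ?f0 ?addr0; last 2 first.
- exact: block_vec_D.
- exact: no_D0 HZ.
have un : 0 < nrm (u (g i)) by apply: lt_le_trans h1; rewrite divr_gt0.
rewrite normrM normfV (gtr0_norm un) ler_pdivrMl// mulrC.
by apply: (le_trans h2); rewrite ler_pM2l.
Qed.

End BlockSequence.

Lemma asymptotic_generates (R : realType) (V : lmodType R) (nrm : V -> R)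
    (y : nat -> V) (M : seq R -> R) (T : smodel R) (J0 : nat) :
  (forall s, 0 <= M s) -> (forall a n, cnorm T a n = M (mkseq a n)) ->
  asymptotic_norm nrm y M ->
  exists g : nat -> nat, [/\ forall i, (g i < g i.+1)%N, forall i, (J0 <= g i)%N &
    generates_sm nrm (fun i => y (g i)) (@sm_seq _ T)].
Proof.
move=> M0 HT Hy.
(* The precision [1 / (n + 2)] fits the rate [1 / (n + 1)] exactly in the lower estimate, as
   [(1 + 1 / (n + 1))^-1 = 1 - 1 / (n + 2)]. *)
have d0 n : 0 < (n.+2%:R^-1 : R) by rewrite invr_gt0 ltr0n.
have /choice[J HJ] n := Hy n _ (d0 n).
(* A diagonal choice that outruns every threshold [J m]. Those up to [m = i.+1] are included since
   [n <= (k 0).+1] admits [n = (k 0).+1]. *)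
pose g i := (J0 + i + \sum_(m < i.+2) J m)%N.
have gS i : (g i < g i.+1)%N.
  have E : (\sum_(m < i.+3) J m = \sum_(m < i.+2) J m + J i.+2)%N by rewrite big_ord_recr.
  by rewrite /g E; lia.
have gmono i j : (i < j)%N -> (g i < g j)%N.
  by apply: (homo_ltn (r := fun a b => (a < b)%N)) => //; exact: ltn_trans.
exists g; split=> //; first by move=> i; rewrite /g -addnA leq_addr.
exists (@harmonic R); split; [|split].
- by move=> n; rewrite /harmonic lef_pV2 ?posrE ?ltr0n// ler_nat.
- exact: cvg_harmonic.
move=> n a k _ nk kS.
have kmono i : (i < n)%N -> (k 0%N <= k i)%N.
  elim: i => // i IH iln; apply: (leq_trans (IH (ltnW iln))).
  by apply: ltnW; exact: kS.
have Jg : (J n <= g (k 0%N))%N.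
  have nk' : (n < (k 0%N).+2)%N by [].
  rewrite /g (bigD1 (Ordinal nk')) //=; lia.
have h := HJ n (mkseq (fun i => g (k i)) n) (mkseq a n).
rewrite !size_mkseq in h.
have {}h : `|nrm (lcomb y (mkseq (fun i => g (k i)) n) (mkseq a n)) - M (mkseq a n)|
    <= n.+2%:R^-1 * M (mkseq a n).
  apply: h => //.
    apply/(sortedP 0%N) => i; rewrite size_mkseq => iln.
    by rewrite !nth_mkseq//; [apply: gmono; exact: kS|exact: ltnW].
  apply/allP => l /mapP[i]; rewrite mem_iota add0n => /andP[_ iln] ->.
  apply: (leq_trans Jg); have := kmono i iln; rewrite leq_eqVlt => /orP[/eqP->//|].
  by move=> /gmono/ltnW.
have E : \sum_(i < n) a i *: y (g (k i)) =
    lcomb y (mkseq (fun i => g (k i)) n) (mkseq a n).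
  rewrite lcombE ?size_mkseq//; apply: eq_bigr => i _.
  by rewrite !nth_mkseq.
have F : `|\sum_(i < n) a i *: sm_seq T i| = M (mkseq a n) by rewrite -HT.
rewrite E F; move: h (M0 (mkseq a n)); move: (M _) (nrm _) => B A.
rewrite ler_norml => /andP[h1 h2] B0; rewrite /harmonic /=.
have n1 : 0 < n.+1%:R :> R by rewrite ltr0n.
have n2 : 0 < n.+2%:R :> R by rewrite ltr0n.
have n21 : n.+2%:R = n.+1%:R + 1 :> R by rewrite -natr1.
split.
  have -> : (1 + n.+1%:R^-1)^-1 = 1 - n.+2%:R^-1 :> R.
    rewrite n21; move: n1; move: (n.+1%:R : R) => w w0; field.
    by rewrite !gt_eqF//; lra.
  by move: h1; move: (n.+2%:R^-1) => e h1; lra.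
have : n.+2%:R^-1 * B <= n.+1%:R^-1 * B.
  by rewrite ler_wpM2r// lef_pV2 ?posrE// ler_nat.
by move: h2; move: (n.+2%:R^-1) (n.+1%:R^-1) => e e' h2 h3; lra.
Qed.

(** The coefficients [al] with respect to [x] do not depend on where a sum of the [z i] is cut, so
    cutting it after [l] blocks cuts a sum of the [x j] at [p l], and the constant of [x] carries
    over. *)
Lemma block_basic_seq (R : realType) (V : lmodType R) (nrm : V -> R)
    (x z : nat -> V) (p : nat -> nat) (c : nat -> nat -> R) :
  basic_seq nrm x -> (forall i, z i != 0) -> (forall i, (p i <= p i.+1)%N) ->
  (forall i j, ~~ (p i <= j < p i.+1)%N -> c i j = 0) ->
  (forall i, z i = \sum_(j < p i.+1) c i j *: x j) -> basic_seq nrm z.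
Proof.
move=> [_ [K HK]] z0 pS c0 Hz; split=> //; exists K => a m n mn.
have pm i j : (i <= j)%N -> (p i <= p j)%N.
  by apply: (homo_leq (r := fun a b => (a <= b)%N)) => //; exact: leq_trans.
pose al j := \sum_(i < n) a i * c i j.
suff E l : (l <= n)%N -> \sum_(i < l) a i *: z i = \sum_(j < p l) al j *: x j.
  by rewrite !E//; apply: HK; exact: pm.
move=> ln; rewrite /al.
under [RHS]eq_bigr => j _ do rewrite scaler_suml.
rewrite exchange_big /=.
rewrite -(big_mkord xpredT (fun i => a i *: z i)).
rewrite -(big_mkord xpredT (fun i => \sum_(j < p l) (a i * c i j) *: x j)).
rewrite [RHS](big_cat_nat (n := l))//=.
rewrite [X in _ = _ + X]big_nat_cond [X in _ = _ + X]big1 ?addr0; last first.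
  move=> i /andP[/andP[li _] _]; apply: big1 => j _.
  rewrite c0 ?mulr0 ?scale0r// negb_and -ltnNge.
  by rewrite (leq_trans (ltn_ord j) (pm _ _ li)).
rewrite [LHS]big_nat_cond [RHS]big_nat_cond; apply: eq_bigr => i /andP[/andP[_ il] _].
rewrite Hz scaler_sumr.
rewrite -(big_mkord xpredT (fun j => a i *: (c i j *: x j))).
rewrite -(big_mkord xpredT (fun j => (a i * c i j) *: x j)).
rewrite [RHS](big_cat_nat (n := p i.+1))//=; last exact: pm.
rewrite [X in _ = _ + X]big_nat_cond [X in _ = _ + X]big1 ?addr0; last first.
  move=> j /andP[/andP[pj _] _].
  by rewrite c0 ?mulr0 ?scale0r// negb_and -!leqNgt pj orbT.
by apply: eq_bigr => j _; rewrite scalerA.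
Qed.

Lemma lcomb_iota (R : realType) (V : lmodType R) (x : nat -> V) m (s : seq R) :
  lcomb x (iota m (size s)) s = \sum_(m <= j < m + size s) nth 0 s (j - m) *: x j.
Proof.
rewrite lcombE ?size_iota// -{2}[m]add0n big_addn addKn big_mkord.
by apply: eq_bigr => i _; rewrite addnK nth_iota// addnC.
Qed.

(** * Gliding hump: submultiplicativity from uniqueness *)

Section GlidingHump.
Variables (R : realType) (V : lmodType R) (D : V -> Prop) (nrm : V -> R).
Hypothesis HZ : normed_on D nrm.

Lemma block_spreading_model (S : smodel R) (beta : nat -> R) :
  weak_spreading_model D nrm S ->
  (forall d, 0 < d -> exists Q, forall k,
     sm_norm S (mkseq (fun q => beta (Q + q)%N) k) <= d) ->
  beta 0%N != 0 ->
  exists2 T, weak_spreading_model D nrm T &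
    exists2 nu, 0 < nu & forall s Q,
      sm_norm S (tensor s (mkseq beta Q)) <= nu * sm_norm T s.
Proof.
move=> [x [xnorm [xbasic [xnull gen]]]] tail beta0.
have HN := sm_norm_ssn HZ xnorm xnull gen.
have HM := block_norm_ssn HN tail beta0.
pose T := ssn_model HM.
have HT a n : cnorm T a n = block_norm (sm_norm S) beta (mkseq a n).
  exact: cnorm_ssn_model.
have [J0 HJ0] := block_seq_pos HZ xnorm xnull gen tail beta0.
have nu0 := block_unit_gt0 HN tail beta0.
set nu := block_unit _ _ in nu0 HJ0.
have [g [gS gJ Tgen]] := asymptotic_generates J0 (ssn_ge0 HM) HT
  (block_seq_asymptotic HZ xnorm xnull gen tail beta0).
pose u := block_vec x beta.
have un i : 0 < nrm (u (g i)).
  by apply: lt_le_trans (HJ0 _ (gJ i)); rewrite divr_gt0.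
pose z i := block_seq nrm x beta (g i).
have znorm i : nrm (z i) = 1.
  rewrite /z /block_seq (no_scale HZ); last exact: (block_vec_D HZ xnull).
  by rewrite gtr0_norm ?invr_gt0// mulVf// gt_eqF.
exists T; last first.
  exists nu => // s Q.
  have -> : sm_norm T s = block_norm (sm_norm S) beta s.
    by rewrite /sm_norm HT mkseq_nth.
  rewrite /block_norm -/nu mulrA mulfV ?gt_eqF// mul1r.
  exact: (block_sup_ge HN tail s Q).
exists z; split=> //; split; last first.
  by split; [exact: (block_seq_null HZ xnorm xnull gen tail beta0 gS)|exact: Tgen].
pose p i := (g i ^ 2)%N.
pose c i j := if (p i <= j < p i + g i)%N then (nrm (u (g i)))^-1 * beta (j - p i)%N else 0.
have ppS i : (p i + g i <= p i.+1)%N by apply: ltnW; apply: square_gap.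
apply: (@block_basic_seq _ _ _ x z p c) => //.
- move=> i; apply/eqP => zi0; have := znorm i.
  by rewrite zi0 (no_nrm0 HZ) => /eqP; rewrite eq_sym oner_eq0.
- by move=> i; apply: leq_trans (ppS i); rewrite leq_addr.
- move=> i j; rewrite /c; case: ifP => // /andP[-> jlt].
  by rewrite (leq_trans jlt (ppS i)).
- move=> i; rewrite /z /block_seq -/(u (g i)); set w := (nrm (u (g i)))^-1.
  rewrite /u /block_vec.
  have := lcomb_iota x (p i) (mkseq beta (g i)); rewrite size_mkseq => ->.
  rewrite -(big_mkord xpredT (fun j => c i j *: x j)).
  rewrite [RHS](big_cat_nat (n := p i))//=; last first.
    by apply: leq_trans (ppS i); rewrite leq_addr.
  rewrite [X in _ = X + _]big_nat_cond [X in _ = X + _]big1 ?add0r; last first.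
    move=> j /andP[/andP[_ jp] _]; rewrite /c leqNgt jp /= scale0r //.
  rewrite [RHS](big_cat_nat (n := p i + g i))//=; last by rewrite leq_addr.
  rewrite [X in _ = _ + X]big_nat_cond [X in _ = _ + X]big1 ?addr0; last first.
    by move=> j /andP[/andP[jp _] _]; rewrite /c [(j < _)%N]ltnNge jp andbF scale0r.
  rewrite scaler_sumr [LHS]big_nat_cond [RHS]big_nat_cond; apply: eq_bigr.
  move=> j /andP[jp _]; rewrite /c jp scalerA nth_mkseq//.
  by move: jp => /andP[]; lia.
Qed.

Hypothesis huniq : forall S1 S2, weak_spreading_model D nrm S1 ->
  weak_spreading_model D nrm S2 -> equiv_cn (cnorm S1) (cnorm S2).

Lemma tensor_submultiplicative (S : smodel R) : weak_spreading_model D nrm S ->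
  exists2 K : R, 1 <= K &
    forall s t, sm_norm S (tensor s t) <= K * (sm_norm S s * sm_norm S t).
Proof.
move=> HS; set N := sm_norm S.
have HN : subsym_norm N.
  by have [x [xnorm [_ [xnull gen]]]] := HS; exact: (sm_norm_ssn HZ xnorm xnull gen).
apply: contrapT => nK.
(* The growth [4 ^ n] outweighs the damping [2^-1 ^ n] chosen below by [2 ^ n]. Normalizing [t] is
   possible, as [N t = 0] would force [N (tensor s t) = 0]. *)
have bad n : exists st : seq R * seq R, N st.2 = 1 /\
    4 ^+ n * N st.1 < N (tensor st.1 st.2).
  apply: contrapT => H; apply: nK; exists (4 ^+ n).
    by rewrite exprn_ege1// ler1n.
  move=> s t; rewrite leNgt; apply/negP => st; apply: H.
  have t0 : 0 < N t.
    rewrite lt_neqAle (ssn_ge0 HN) andbT eq_sym; apply/eqP => t0.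
    have := ssn_tensor_le HN s t; have := ssn_ge0 HN (tensor s t).
    move: st; rewrite t0 !mulr0; lra.
  exists (s, [seq (N t)^-1 * a | a <- t]) => /=.
  rewrite tensor_scaler !(ssn_scale HN) gtr0_norm ?invr_gt0// mulVf ?gt_eqF//.
  by split=> //; rewrite ltr_pdivlMl// mulrC -mulrA.
have {bad}/choice[st Hst] := bad.
pose t n := (st n).2; pose s n := (st n).1.
have t1 n : N (t n) = 1 by have [] := Hst n.
have stn n : 4 ^+ n * N (s n) < N (tensor (s n) (t n)) by have [] := Hst n.
pose h n : R := 2^-1 ^+ n.
have h0 n : 0 < h n by rewrite exprn_gt0// invr_gt0.
(* The lists [B n] are finite prefixes of [beta]. Starting from [[:: 1]] ensures that [beta 0] is
   nonzero. *)
have [B [B0 BS]] : exists B : nat -> seq R, B 0%N = [:: 1] /\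
    forall n, B n.+1 = B n ++ [seq h n * a | a <- t n].
  by exists (fix B n := if n is n'.+1 then B n' ++ [seq h n' * a | a <- t n'] else [:: 1]).
have szt n : (0 < size (t n))%N.
  case E : (t n) (t1 n) => [|//]; rewrite (ssn_nil HN) => /esym/eqP.
  by rewrite oner_eq0.
have szBD n k : (size (B n) + k <= size (B (n + k)%N))%N.
  elim: k => [|k IH]; first by rewrite !addn0.
  by rewrite !addnS BS size_cat size_map -addn1 leq_add.
have szB n : (n < size (B n))%N by have := szBD 0%N n; rewrite add0n B0.
have Bcoh n k q : (q < size (B n))%N -> nth 0 (B (n + k)%N) q = nth 0 (B n) q.
  move=> qn; elim: k => [|k IH]; first by rewrite addn0.
  rewrite addnS BS nth_cat -IH ifT//.
  exact: leq_trans qn (leq_trans (leq_addr k _) (szBD n k)).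
(* Reading [B q] at position [q] never meets the default 0: the [t n] are nonempty, so [B q] has
   more than [q] entries. *)
pose beta q := nth 0 (B q) q.
have betaE n q : (q < size (B n))%N -> beta q = nth 0 (B n) q.
  move=> qn; rewrite /beta; have [le|le] := leqP q n.
    by rewrite -(subnKC le) Bcoh.
  by have := Bcoh n (q - n)%N q qn; rewrite subnKC ?(ltnW le).
have mkB n : mkseq beta (size (B n)) = B n.
  rewrite -[RHS](mkseq_nth 0); apply/eq_in_map => q.
  by rewrite mem_iota add0n => /andP[_]; exact: betaE.
have tailB n k : N (drop (size (B n)) (B (n + k)%N)) <= 2 * h n - 2 * h (n + k)%N.
  elim: k => [|k IH]; first by rewrite addn0 drop_size (ssn_nil HN) subrr.
  rewrite addnS BS drop_cat.
  have -> : (if (size (B n) < size (B (n + k)%N))%N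
      then drop (size (B n)) (B (n + k)%N) ++ [seq h (n + k)%N * a | a <- t (n + k)%N]
      else drop (size (B n) - size (B (n + k)%N)) [seq h (n + k)%N * a | a <- t (n + k)%N]) =
      drop (size (B n)) (B (n + k)%N) ++ [seq h (n + k)%N * a | a <- t (n + k)%N].
    case: ltnP => // le; have E : size (B n) = size (B (n + k)%N).
      by apply/eqP; rewrite eqn_leq le andbT (leq_trans (leq_addr k _) (szBD n k)).
    by rewrite E subnn drop0 drop_size.
  apply: (le_trans (ssn_cat HN _ _)); rewrite (ssn_scale HN) t1 mulr1 gtr0_norm//.
  have -> : h (n + k).+1 = 2^-1 * h (n + k)%N by rewrite /h exprS.
  move: IH; lra.
have pow_big (c : R) : exists n, c < 2 ^+ n.
  exists (Num.trunc `|c|).+1; apply: le_lt_trans (ler_norm c) _.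
  apply: (@lt_trans _ _ (Num.trunc `|c|).+1%:R).
    exact: Num.Theory.truncnS_gt.
  by rewrite -natrX ltr_nat ltn_expl.
have tail d : 0 < d -> exists Q, forall k,
    N (mkseq (fun q => beta (Q + q)%N) k) <= d.
  move=> d0; have [n Hn] := pow_big (2 / d); exists (size (B n)) => k.
  apply: (@le_trans _ _ (N (drop (size (B n)) (B (n + k)%N)))); last first.
    apply: (le_trans (tailB n k)); apply: (@le_trans _ _ (2 * h n)).
      by rewrite lerBlDr lerDl mulr_ge0// ltW.
    rewrite /h exprVn ler_pdivrMr ?exprn_gt0//.
    by move: Hn; rewrite ltr_pdivrMr// mulrC => /ltW.
  apply: (ssn_subseq HN).
  have -> : mkseq (fun q => beta (size (B n) + q)%N) k =
      take k (drop (size (B n)) (B (n + k)%N)).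
    have sz := szBD n k.
    apply: (@eq_from_nth _ 0).
      by rewrite size_mkseq size_takel// size_drop leq_subRL// (leq_trans (leq_addr k _) sz).
    rewrite size_mkseq => q qk; rewrite nth_mkseq// nth_take// nth_drop.
    by apply: betaE; apply: leq_trans sz; rewrite ltn_add2l.
  exact: take_subseq.
have beta0 : beta 0%N != 0 by rewrite /beta B0 oner_eq0.
have [T HT [nu nu0 Hnu]] := block_spreading_model HS tail beta0.
have [C [C0 HC]] := huniq HT HS.
(* Both [nu] and [C] belong to the single model [T] and are already fixed, so [n] can be taken large
   against their product. *)
have [n Hn] := pow_big (nu * C).
have [_ hC] := HC (nth 0 (s n)) (size (s n)).
rewrite -/(sm_norm T (s n)) -/(sm_norm S (s n)) -/N in hC.
have := Hnu (s n) (size (B n.+1)); rewrite -/N mkB => hn.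
have : N (tensor (s n) [seq h n * a | a <- t n]) <= nu * sm_norm T (s n).
  apply: le_trans hn; apply: (ssn_subseq HN); apply: tensor_subseq.
  by rewrite BS suffix_subseq.
rewrite tensor_scaler (ssn_scale HN) gtr0_norm// => h1.
have h2 : h n * (4 ^+ n * N (s n)) < nu * (C * N (s n)).
  apply: (@lt_le_trans _ _ (h n * N (tensor (s n) (t n)))); first by rewrite ltr_pM2l.
  by apply: (le_trans h1); rewrite ler_pM2l.
move: h2; rewrite mulrA.
have -> : h n * 4 ^+ n = 2 ^+ n.
  by rewrite /h -exprMn; congr (_ ^+ _); field.
rewrite mulrA; apply/negP; rewrite -leNgt ler_wpM2r ?(ssn_ge0 HN)//.
exact: ltW.
Qed.

End GlidingHump.

(** * Hahn-Banach *)

Section HahnBanach.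
Variables (R : realType) (V : lmodType R).

Definition sublinear (p : V -> R) : Prop :=
  (forall u v, p (u + v) <= p u + p v) /\
  (forall (c : R) u, 0 < c -> p (c *: u) <= c * p u).

Lemma sublinear0 p : sublinear p -> p 0 = 0.
Proof.
move=> [pD pZ]; have := pD 0 0; rewrite addr0.
have h : 0 < 2^-1 :> R by rewrite invr_gt0.
have := pZ _ 0 h; rewrite scaler0; lra.
Qed.

Lemma sublinearZ p (c : R) u : sublinear p -> 0 < c -> p (c *: u) = c * p u.
Proof.
move=> [_ pZ] c0; apply/eqP; rewrite eq_le pZ//=.
have ci : 0 < c^-1 by rewrite invr_gt0.
have := pZ _ (c *: u) ci; rewrite scalerA mulVf ?gt_eqF// scale1r.
by rewrite ler_pdivlMl.
Qed.

Lemma sublinearN p u : sublinear p -> - p (- u) <= p u.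
Proof. by move=> sp; have := (proj1 sp) u (- u); rewrite subrr (sublinear0 sp); lra. Qed.

(** The usual device for making a sublinear functional linear in the direction [x]: for sublinear
    [p] it lies below [p] and takes at [- x] a value at most [- p x]. *)
Definition shear (p : V -> R) (x v : V) : R :=
  inf [set r | exists2 t : R, 0 <= t & r = p (v + t *: x) - t * p x].

Section Shear.
Variables (p : V -> R) (x : V).
Hypothesis sp : sublinear p.

Let A v := [set r | exists2 t : R, 0 <= t & r = p (v + t *: x) - t * p x].

Let A_lb v : lbound (A v) (- p (- v)).
Proof.
move=> _ [t t0 ->].
have := (proj1 sp) (v + t *: x) (- v); rewrite addrAC subrr add0r.
have [->|tN] := eqVneq t 0; first by rewrite scale0r (sublinear0 sp) mul0r addr0; lra.
by rewrite sublinearZ// ?lt_neqAle 1?eq_sym ?tN//; lra.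
Qed.

Let A_ne v : A v !=set0.
Proof. by exists (p (v + 0 *: x) - 0 * p x); exists 0. Qed.

Lemma shear_le_at v (t : R) : 0 <= t -> shear p x v <= p (v + t *: x) - t * p x.
Proof. by move=> t0; apply: ge_inf; [exists (- p (- v)); exact: A_lb|exists t]. Qed.

Lemma shear_le v : shear p x v <= p v.
Proof. by have := shear_le_at v (lexx 0); rewrite scale0r addr0 mul0r subr0. Qed.

Lemma shear_sublinear : sublinear (shear p x).
Proof.
split=> [u v|c u c0].
  rewrite -lerBlDr; apply: lb_le_inf; [exact: A_ne|] => _ [t t0 ->].
  rewrite lerBlDr -lerBlDl; apply: lb_le_inf; [exact: A_ne|] => _ [r r0 ->].
  rewrite lerBlDl; have tr : 0 <= t + r by rewrite addr_ge0.
  apply: (le_trans (shear_le_at (u + v) tr)).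
  have := (proj1 sp) (u + t *: x) (v + r *: x).
  by rewrite addrACA -scalerDl; lra.
rewrite -ler_pdivrMl//; apply: lb_le_inf; [exact: A_ne|] => _ [t t0 ->].
rewrite ler_pdivrMl//; have ct : 0 <= c * t by rewrite mulr_ge0// ltW.
apply: (le_trans (shear_le_at (c *: u) ct)).
by rewrite -scalerA -scalerDr sublinearZ// mulrBr mulrA.
Qed.

End Shear.

(* A minimal sublinear functional is linear: it coincides with all its shears. *)
Lemma sublinear_minorant (q : V -> R) : sublinear q ->
  exists2 f : V -> R, (forall (c : R) u v, f (c *: u + v) = c * f u + f v) &
    forall v, f v <= q v.
Proof.
move=> sq; pose T := {p : V -> R | sublinear p /\ forall v, p v <= q v}.
(* The order is reversed, so that the maximal element given by Zorn is a minimal functional. *)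
pose rel (p1 p2 : T) := `[< forall v, sval p2 v <= sval p1 v >].
have [||||m mmin] := @Zorn T rel.
- by move=> t; apply/asboolP.
- move=> r s t /asboolP rs /asboolP st; apply/asboolP => v.
  exact: le_trans (st v) (rs v).
- move=> [s Hs] [t Ht] /asboolP /= st /asboolP /= ts; apply: eq_exist.
  by apply/funext => v; apply/eqP; rewrite eq_le st ts.
- move=> A totA; have [[p0 Ap0]|A0] := pselect (exists p, A p); last first.
    exists (exist _ q (conj sq (fun v => lexx (q v)))) => s As.
    by exfalso; apply: A0; exists s.
  (* A sublinear [p] below [q] satisfies [p v >= - p (- v) >= - q (- v)], so the pointwise infimum
     over a chain is finite. *)
  pose B v := [set r | exists2 p : T, A p & r = sval p v].
  have Blb v : lbound (B v) (- q (- v)).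
    move=> _ [[p [sp pq]] _ ->] /=; have := sublinearN v sp; have := pq (- v); lra.
  have Bne v : B v !=set0 by exists (sval p0 v); exists p0.
  pose m v := inf (B v).
  have mle p v : A p -> m v <= sval p v.
    by move=> Ap; apply: ge_inf; [exists (- q (- v)); exact: Blb|exists p].
  have sm : sublinear m.
    split=> [u v|c u c0].
      rewrite -lerBlDr; apply: lb_le_inf; [exact: Bne|] => _ [p1 Ap1 ->].
      rewrite lerBlDr -lerBlDl; apply: lb_le_inf; [exact: Bne|] => _ [p2 Ap2 ->].
      rewrite lerBlDl.
      (* Totality of the chain lets the smaller of [p1] and [p2] serve both vectors. *)
      have [/asboolP h|/asboolP h] := totA _ _ Ap1 Ap2.
        apply: (le_trans (mle p2 (u + v) Ap2)).
        apply: (le_trans ((proj1 (proj1 (svalP p2))) u v)).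
        by rewrite lerD2r h.
      apply: (le_trans (mle p1 (u + v) Ap1)).
      apply: (le_trans ((proj1 (proj1 (svalP p1))) u v)).
      by rewrite lerD2l h.
    rewrite -ler_pdivrMl//; apply: lb_le_inf; [exact: Bne|] => _ [p Ap ->].
    rewrite ler_pdivrMl//; apply: (le_trans (mle p _ Ap)).
    exact: (proj2 (proj1 (svalP p))).
  have mq v : m v <= q v by exact: le_trans (mle p0 v Ap0) (proj2 (svalP p0) v).
  exists (exist _ m (conj sm mq)) => s As; apply/asboolP => v /=.
  exact: mle.
case: m mmin => f [sf fq] mmin; exists f => //.
have fD u v : f (u + v) = f u + f v.
  apply/eqP; rewrite eq_le (proj1 sf)/=.
  have sq' w : shear f v w <= q w by exact: le_trans (shear_le v sf w) (fq w).
  pose g : T := exist _ (shear f v) (conj (shear_sublinear v sf) sq').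
  have /(mmin g)/(congr1 sval) /= E : rel (exist _ f (conj sf fq)) g.
    by apply/asboolP => w /=; exact: shear_le.
  (* By minimality the shear along [v] equals [f], so its bound at [t = 1] reads
     [f u <= f (u + v) - f v]. *)
  by have := shear_le_at v sf u ler01; rewrite E scale1r mul1r; lra.
have fN u : f (- u) = - f u.
  by have := fD u (- u); rewrite subrr (sublinear0 sf); lra.
move=> c u v; rewrite fD; congr (_ + _).
have [c0|c0|->] := ltgtP c 0.
- have c0' : 0 < - c by rewrite oppr_gt0.
  rewrite -[c in LHS]opprK scaleNr fN sublinearZ//; ring.
- by rewrite sublinearZ.
- by rewrite scale0r mul0r (sublinear0 sf).
Qed.

End HahnBanach.

(** A linear minorant of the norm sheared along [w] satisfies [f (- w) <= - |w|], hence
    [f w >= |w|]. *)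
Lemma norming_functional (R : realType) (W : normedModType R) (w : W) :
  exists f : W -> R, [/\ forall (c : R) u v, f (c *: u + v) = c * f u + f v,
    forall u, `|f u| <= `|u| & f w = `|w|].
Proof.
pose p (u : W) := `|u|.
have sp : sublinear p.
  by split=> [u v|c u c0]; [exact: ler_normD|rewrite /p normrZ gtr0_norm].
have [f flin fq] := sublinear_minorant (shear_sublinear w sp).
have f0 : f 0 = 0.
  by have := flin (-1) 0 0; rewrite scaleN1r oppr0 addr0 mulN1r addNr.
have fN u : f (- u) = - f u.
  by have := flin (-1) u 0; rewrite scaleN1r !addr0 f0 addr0 mulN1r.
have fle u : f u <= `|u| by exact: le_trans (fq u) (shear_le w sp u).
exists f; split=> // [u|].
  rewrite ler_norml fle andbT lerNl -fN.
  by apply: (le_trans (fle _)); rewrite normrN.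
apply/eqP; rewrite eq_le fle /=.
have := le_trans (fq (- w)) (shear_le_at w sp (- w) ler01).
by rewrite fN scale1r addNr /p normr0 mul1r; lra.
Qed.

(** * Duality *)

Section DualSpace.
Variables (R : realType) (X : completeNormedModType R).

Lemma in_dualP (f : X -> R) :
  in_dual f <-> bounded_functional (fun _ : X => True) (fun v : X => `|v|) f.
Proof.
split=> [[flin fc]|[flin [C HC]]].
  split=> [c u v _ _|]; first exact: flin.
  have f0 : f 0 = 0.
    by have := flin (-1) 0 0; rewrite scaleN1r oppr0 addr0 mulN1r addNr.
  have /cvgrPdist_lt/(_ 1 ltr01) := fc 0; rewrite f0.
  move=> /nbhs_normP[e /= e0 He]; exists (2 / e) => v _.
  have [->|v0] := eqVneq v 0; first by rewrite f0 !normr0 mulr0.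
  have nv : 0 < `|v| by rewrite normr_gt0.
  pose k := e / (2 * `|v|).
  have k0 : 0 < k by rewrite divr_gt0// mulr_gt0.
  have := He (k *: v); rewrite /ball_ /= !sub0r !normrN normrZ gtr0_norm//.
  have -> : f (k *: v) = k * f v.
    by have := flin k v 0; rewrite addr0 f0 addr0.
  have -> : k * `|v| = e / 2 by rewrite /k; field; rewrite gt_eqF.
  rewrite normrM (gtr0_norm k0) => h; have {}h : k * `|f v| < 1 by apply: h; lra.
  apply: ltW; rewrite -(ltr_pM2l k0); apply: (lt_le_trans h).
  by rewrite le_eqVlt; apply/orP; left; apply/eqP; rewrite /k; field; rewrite !gt_eqF.
have flin' c u v : f (c *: u + v) = c * f u + f v by exact: flin.
split=> // x; apply/cvgrPdist_lt => e e0.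
have C1 : 0 < `|C| + 1 by rewrite ltr_wpDl.
have d0 : 0 < e / (`|C| + 1) by rewrite divr_gt0.
apply/nbhs_normP; exists (e / (`|C| + 1)) => //= y; rewrite /ball_ /= => xy.
have -> : f x - f y = f (x - y).
  have -> : x - y = -1 *: y + x by rewrite scaleN1r addrC.
  by rewrite flin'; ring.
apply: (le_lt_trans (HC _ I)); apply: (@le_lt_trans _ _ ((`|C| + 1) * `|x - y|)).
  by rewrite ler_wpM2r//; have := ler_norm C; lra.
by move: xy; rewrite ltr_pdivlMr// mulrC.
Qed.

Lemma in_dual_bound (f : X -> R) : in_dual f ->
  exists2 C, 0 <= C & forall x, `|f x| <= C * `|x|.
Proof.
move=> /in_dualP[_ [C HC]]; exists `|C| => // x.
by apply: (le_trans (HC x I)); rewrite ler_wpM2r// ler_norm.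
Qed.

Lemma dual_norm_has_sup (f : X -> R) : in_dual f ->
  has_sup [set r : R | exists x : X, `|x| <= 1 /\ r = `|f x|].
Proof.
move=> /in_dual_bound[C C0 HC]; split; first by exists `|f 0|; exists 0; rewrite normr0.
exists C => _ [x [x1 ->]]; apply: (le_trans (HC x)).
by rewrite -[leRHS]mulr1 ler_wpM2l.
Qed.

Lemma dual_norm_ge (f : X -> R) x : in_dual f -> `|x| <= 1 -> `|f x| <= dual_norm f.
Proof.
move=> /dual_norm_has_sup[_ hu] x1; apply: (sup_ubound hu).
by exists x.
Qed.

Lemma dual_norm_le (f : X -> R) c :
  (forall x, `|x| <= 1 -> `|f x| <= c) -> dual_norm f <= c.
Proof.
move=> H; apply: ge_sup => [|_ [x [x1 ->]]]; last exact: H.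
by exists `|f 0|; exists 0; rewrite normr0.
Qed.

Lemma space_normed_on : normed_on (fun _ : X => True) (fun v : X => `|v|).
Proof.
split=> //.
- by move=> u v _ _; exact: ler_normD.
- by move=> c u _; exact: normrZ.
- move=> v d _ d0; have [f [flin fb fv]] := norming_functional v; exists f; split.
  + by move=> c u w _ _; exact: flin.
  + by move=> u _; exact: fb.
  + by rewrite fv; lra.
Qed.

Lemma in_dual_lin (c : R) (f g : X -> R) : in_dual f -> in_dual g -> in_dual (c *: f + g).
Proof.
move=> df dg; have [C C0 HC] := in_dual_bound df; have [E E0 HE] := in_dual_bound dg.
apply/in_dualP; split.
  move=> k u v _ _; rewrite /= !fctE (proj1 df) (proj1 dg) /= /GRing.scale /=; ring.
exists (`|c| * C + E) => v _; rewrite mulrDl.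
have -> : (c *: f + g) v = c * f v + g v by [].
apply: (le_trans (ler_normD _ _)); apply: lerD => //.
by rewrite normrM -mulrA ler_wpM2l.
Qed.

(** The functionals demanded by [no_norming] are signed evaluations at nearly norming points of the
    unit ball. *)
Lemma dual_normed_on : normed_on (@in_dual R X) (@dual_norm R X).
Proof.
split.
- apply/in_dualP; split; first by move=> c u v _ _; rewrite /= mulr0 addr0.
  by exists 0 => v _; rewrite mul0r normr0.
- exact: in_dual_lin.
- move=> f g df dg; apply: dual_norm_le => x x1.
  by apply: (le_trans (ler_normD _ _)); apply: lerD; exact: dual_norm_ge.
- move=> c f df.
  have H (k : R) (g : X -> R) : in_dual g -> dual_norm (k *: g) <= `|k| * dual_norm g.
    move=> dg; apply: dual_norm_le => x x1.
    have -> : (k *: g) x = k * g x by [].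
    by rewrite normrM ler_wpM2l// dual_norm_ge.
  apply/eqP; rewrite eq_le H//=.
  have [->|c0] := eqVneq c 0.
    rewrite normr0 mul0r scale0r.
    by apply: le_trans (normr_ge0 ((0 : X -> R) 0)) _; apply: dual_norm_ge;
      rewrite ?normr0//; apply/in_dualP; split;
      [move=> k u v _ _; rewrite /= mulr0 addr0|exists 0 => v _; rewrite mul0r normr0].
  have dcf : in_dual (c *: f).
    rewrite -[c *: f]addr0; apply: in_dual_lin => //.
    apply/in_dualP; split; first by move=> k u v _ _; rewrite /= mulr0 addr0.
    by exists 0 => v _; rewrite mul0r normr0.
  have := H c^-1 _ dcf; rewrite scalerA mulVf// scale1r normfV.
  by rewrite ler_pdivlMl ?normr_gt0.
- move=> g d dg d0.
  have [_ [x [x1 ->]] hx] := sup_adherent d0 (dual_norm_has_sup dg).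
  exists (fun h => Num.sg (g x) * h x); split.
  + by move=> c u w _ _; have -> : (c *: u + w) x = c * u x + w x by []; ring.
  + move=> h dh; rewrite normrM; apply: le_trans (dual_norm_ge dh x1).
    by rewrite -[leRHS]mul1r ler_wpM2r// normr_sg lern1 leq_b1.
  + by rewrite /= -normrEsg ltW.
Qed.

Lemma SPw_weak_spreading_model S :
  SPw X S <-> weak_spreading_model (fun _ : X => True) (fun v : X => `|v|) S.
Proof.
split=> -[x [xnorm [xbasic [xnull gen]]]]; exists x; do 3 split=> //.
- by split=> // f /in_dualP; exact: xnull.
- by move=> f /in_dualP; exact: (proj2 xnull).
Qed.

End DualSpace.

(** * Pairing with the biorthogonal functionals *)

Definition dot (R : realType) (s t : seq R) : R := \sum_(p <- zip s t) p.1 * p.2.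

Lemma dot_tensor (R : realType) (s s' t t' : seq R) :
  size s = size s' -> size t = size t' ->
  dot (tensor s t) (tensor s' t') = dot s s' * dot t t'.
Proof.
move=> + szt; elim: s s' => [|a s IH] [|a' s'] //.
  by rewrite /dot /= !big_nil mul0r.
move=> [sz]; rewrite !tensor_cons /dot zip_cat ?size_map// big_cat /=.
rewrite -/(dot _ _) -/(dot (tensor s t) _) IH// big_cons -/(dot s s') mulrDl; congr (_ + _).
elim: t t' szt {IH} => [|c t IH] [|c' t'] //=; first by rewrite /dot /= !big_nil mulr0.
by move=> [szt]; rewrite /dot /= !big_cons -!/(dot _ _) IH// mulrDr; congr (_ + _); rewrite /=; ring.
Qed.

Lemma dotE (R : realType) (s t : seq R) : size s = size t ->
  dot s t = \sum_(i < size s) s`_i * t`_i.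
Proof.
move=> sz; rewrite /dot (big_nth (0, 0)) size_zip sz minnn big_mkord.
by apply: eq_bigr => i _; rewrite nth_zip.
Qed.

Section Duality.
Variables (R : realType) (S : smodel R).
Let N := sm_norm S.
Hypothesis HN : subsym_norm N.

Definition biorth_norm (s : seq R) := biorth_cnorm S (nth 0 s) (size s).

Let B b := [set r : R | exists (m : nat) (a : nat -> R),
  `|\sum_(j < m) a j *: sm_seq S j| <= 1 /\
  r = \sum_(i < minn (size b) m) nth 0 b i * a i].

(** A [sup] is informative only on bounded sets. Suppression bounds each [a i] by 1 in modulus, so
    the l_1 norm of [b] is an upper bound. *)
Let B_has_sup b : has_sup (B b).
Proof.
split; first by exists 0; exists 0%N, (fun=> 0); rewrite minn0 !big_ord0 normr0.
exists (\sum_(c <- b) `|c|) => _ [m [a [a1 ->]]].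
have a1' : N (mkseq a m) <= 1 by rewrite /N sm_norm_mkseq.
apply: (@le_trans _ _ (\sum_(i < minn (size b) m) `|nth 0 b i|)).
  apply: ler_sum => i _; apply: (le_trans (ler_norm _)); rewrite normrM.
  rewrite -[leRHS]mulr1 ler_wpM2l//; apply: le_trans a1'.
  apply: (ssn_ge_mem HN); apply/mapP; exists (i : nat) => //.
  by rewrite mem_iota /=; have := ltn_ord i; rewrite leq_min => /andP[].
rewrite (big_nth 0) big_mkord -(big_mkord xpredT (fun i => `|nth 0 b i|)).
rewrite -[leRHS](big_mkord xpredT (fun i => `|nth 0 b i|)).
rewrite [leRHS](big_cat_nat (n := minn (size b) m))//= ?geq_minl// lerDl.
by apply: sumr_ge0.
Qed.

Lemma dot_le_biorth b a : size b = size a -> dot b a <= biorth_norm b * N a.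
Proof.
move=> sz.
have [Na|Na] := eqVneq (N a) 0.
  rewrite Na mulr0 dotE// big1// => i _.
  have : `|a`_i| <= N a by apply: (ssn_ge_mem HN); rewrite mem_nth// -sz.
  by rewrite Na normr_le0 => /eqP->; rewrite mulr0.
have N0 : 0 < N a by rewrite lt_neqAle eq_sym Na (ssn_ge0 HN).
rewrite -ler_pdivrMr//; apply: (sup_ubound (proj2 (B_has_sup b))).
exists (size b), (fun i => (N a)^-1 * a`_i); split.
  have -> : \sum_(j < size b) ((N a)^-1 * a`_j) *: sm_seq S j =
      (N a)^-1 *: \sum_(j < size a) a`_j *: sm_seq S j.
    by rewrite sz scaler_sumr; apply: eq_bigr => j _; rewrite scalerA.
  rewrite normrZ gtr0_norm ?invr_gt0// -/(cnorm S (nth 0 a) (size a)).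
  by rewrite -/(sm_norm S a) -/N mulVf.
rewrite minnn dotE// mulr_suml; apply: eq_bigr => i _.
by rewrite mulrAC mulrA.
Qed.

(** The entries of [b] are the values at the [sm_seq S i] of a functional norming the combination
    with coefficients [a]; suppression handles test vectors longer than [a]. *)
Lemma biorth_norming a : exists b, [/\ size b = size a, biorth_norm b <= 1 &
  dot b a = N a].
Proof.
have [f [flin fb fw]] := norming_functional (\sum_(i < size a) a`_i *: sm_seq S i).
have f0 : f 0 = 0.
  by have := flin (-1) 0 0; rewrite scaleN1r oppr0 addr0 mulN1r addNr.
have fsum n (c : nat -> R) : f (\sum_(i < n) c i *: sm_seq S i) = \sum_(i < n) c i * f (sm_seq S i).
  elim: n => [|n IH]; first by rewrite !big_ord0.
  by rewrite !big_ord_recr /= addrC flin IH addrC.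
exists (mkseq (fun i => f (sm_seq S i)) (size a)); rewrite size_mkseq; split=> //.
  rewrite /biorth_norm size_mkseq; apply: ge_sup.
    by have := proj1 (B_has_sup (mkseq (fun i => f (sm_seq S i)) (size a))); rewrite /B size_mkseq.
  move=> _ [m [c [c1 ->]]].
  have -> : \sum_(i < minn (size a) m) nth 0 (mkseq (fun i => f (sm_seq S i)) (size a)) i * c i =
      f (\sum_(i < minn (size a) m) c i *: sm_seq S i).
    rewrite fsum; apply: eq_bigr => i _; rewrite nth_mkseq 1?mulrC//.
    by have := ltn_ord i; rewrite leq_min => /andP[].
  apply: (le_trans (ler_norm _)); apply: (le_trans (fb _)); apply: le_trans c1.
  rewrite -!/(cnorm S _ _) -!sm_norm_mkseq -/N; apply: (ssn_subseq HN).
  have mm : (minn (size a) m <= m)%N by exact: geq_minr.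
  by rewrite -{2}(subnKC mm) mkseqD prefix_subseq.
rewrite dotE size_mkseq// /N /sm_norm /cnorm -fw fsum; apply: eq_bigr => i _.
by rewrite nth_mkseq// mulrC.
Qed.

Lemma tensor_supermultiplicative K :
  (forall s t, biorth_norm (tensor s t) <= K * (biorth_norm s * biorth_norm t)) ->
  0 <= K -> forall s t, N s * N t <= K * N (tensor s t).
Proof.
move=> HK K0 s t.
have [s' [szs s1 <-]] := biorth_norming s; have [t' [szt t1 <-]] := biorth_norming t.
have bge b : 0 <= biorth_norm b.
  apply: (sup_ubound (proj2 (B_has_sup b))).
  by exists 0%N, (fun=> 0); rewrite minn0 !big_ord0 normr0.
rewrite -dot_tensor//; apply: (le_trans (dot_le_biorth _)).
  by rewrite !size_tensor szs szt.
rewrite ler_wpM2r ?(ssn_ge0 HN)//; apply: (le_trans (HK _ _)).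
by rewrite -[leRHS]mulr1 ler_wpM2l// mulr_ile1.
Qed.

End Duality.

Theorem theorem1p10 (R : realType) (X : completeNormedModType R)
  (hsep : separable_space X) (hrefl : reflexive_space X) (hinf : infinite_dim X)
  (hSPX : unique_class (@SPw R X)) (hSPXs : unique_class (@SPw_dual R X))
  (S : smodel R) (hS : SPw X S)
  (hdual : forall M : smodel R, SPw_dual X M -> equiv_cn (cnorm M) (biorth_cnorm S)) :
  equiv_cn (cnorm S) (@c0_cn R) \/
  exists p : R, 1 <= p /\ equiv_cn (cnorm S) (lp_cn p).
Proof.
have HX := @space_normed_on R X.
have HXs := @dual_normed_on R X.
have wS : weak_spreading_model (fun _ : X => True) (fun v : X => `|v|) S.
  exact/SPw_weak_spreading_model.
have HN : subsym_norm (sm_norm S).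
  by have [x [xnorm [_ [xnull gen]]]] := wS; exact: (sm_norm_ssn HX xnorm xnull gen).
have [|K1 K11 HK1] := tensor_submultiplicative HX _ wS.
  move=> S1 S2 /SPw_weak_spreading_model h1 /SPw_weak_spreading_model h2.
  exact: (proj2 hSPX).
have [[M hM] uniqM] := hSPXs.
(* [SPw_dual X] unfolds to [weak_spreading_model] for [in_dual] and [dual_norm], so it needs no
   translation as [SPw X] does. *)
have [K2 K21 HK2] := tensor_submultiplicative HXs uniqM hM.
have [C [C0 HC]] := hdual M hM.
have low s : sm_norm M s <= C * biorth_norm S s by have [] := HC (nth 0 s) (size s).
have upp s : biorth_norm S s <= C * sm_norm M s.
  by have [+ _] := HC (nth 0 s) (size s); rewrite ler_pdivrMl.
have K20 : 0 < K2 by lra.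
(* One [C] passes from [biorth_norm] of the tensor product to the dual model, and the other two
   return on the factors. *)
pose K3 := C * (K2 * (C * C)).
have K30 : 0 < K3 by rewrite !mulr_gt0.
have HK3 s t : biorth_norm S (tensor s t) <= K3 * (biorth_norm S s * biorth_norm S t).
  apply: (le_trans (upp _)); rewrite /K3 -!mulrA ler_pM2l//.
  apply: (le_trans (HK2 _ _)); rewrite ler_pM2l//.
  apply: (le_trans (ler_pM (normr_ge0 _) (normr_ge0 _) (low s) (low t))).
  by rewrite mulrACA -mulrA.
have super := tensor_supermultiplicative HN HK3 (ltW K30).
pose K := Num.max K1 K3.
have K1K : K1 <= K by rewrite le_max lexx.
have K3K : K3 <= K by rewrite le_max lexx orbT.
have K1' : 1 <= K by exact: le_trans K11 K1K.
have K0 : 0 < 2 * K by rewrite mulr_gt0// (lt_le_trans ltr01).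
have [||c0|[p [p1 lp]]] := @multiplicative_ssn _ _ K HN K1'.
- move=> s t; apply: (le_trans (HK1 s t)); rewrite ler_wpM2r//.
  by rewrite mulr_ge0// (ssn_ge0 HN).
- move=> s t; apply: (le_trans (super s t)); rewrite ler_wpM2r//.
  exact: (ssn_ge0 HN).
- left; exists (2 * K); split=> // a n; rewrite -sm_norm_mkseq; split.
    rewrite ler_pdivrMl//; apply: (@le_trans _ _ (sm_norm S (mkseq a n))).
      apply: bigmax_le; first exact: (ssn_ge0 HN).
      by move=> i _; apply: (ssn_ge_mem HN); apply/mapP; exists (i : nat); rewrite ?mem_iota/=.
    rewrite -[leLHS]mul1r ler_wpM2r ?(ssn_ge0 HN)//; lra.
  apply: c0; first exact: bigmax_ge_id.
  apply/allP => y /mapP[i]; rewrite mem_iota add0n => /andP[_ ilt] ->.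
  exact: (le_bigmax _ (fun i : 'I_n => `|a i|) (Ordinal ilt)).
right; exists p; split=> //; exists (2 * K); split=> // a n.
have -> : lp_cn p a n = (\sum_(x <- mkseq a n) `|x| `^ p) `^ p^-1.
  by rewrite /lp_cn -(big_mkord xpredT (fun i => `|a i| `^ p)) big_map /index_iota subn0.
rewrite -sm_norm_mkseq ler_pdivrMl//.
by have [] := lp (mkseq a n).
Qed.
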